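(* Let $R,S\in\mathcal{R}(d)$ be R-matrices. (a) $\phi_R(R)=\phi_F(R)=\phi_F(FRF)$, and this is a normal element of $\mathcal{F}_d^1$ with norm $\|\phi_R(R)\|\le1$. In particular, $R$ has identical left and right partial traces, i.e. $(\mathrm{Tr}\otimes\mathrm{id})(R)=(\mathrm{id}\otimes\mathrm{Tr})(R)$ in $M_d$. (b) $\tau\big(R\varphi(R)\cdots\varphi^{n-1}(R)\big)=\tau\big(\phi_R(R)^n\big)$ for all $n\in\mathbb{N}_0$. (c) If $R\sim S$, then $\phi_R(R)$ and $\phi_S(S)$ are unitarily similar, i.e. $\phi_R(R)=u\,\phi_S(S)\,u^*$ for some unitary $u\in\mathcal{F}_d^1$.
   Context: Let $d\ge 2$. $\mathcal{O}_d$ is the Cuntz algebra generated by isometries $S_1,\dots,S_d$ with $S_i^*S_j=\delta_{ij}1$, $\sum_iS_iS_i^*=1$. $\mathcal{F}_d^n=\mathrm{span}\{S_\mu S_\nu^*:|\mu|=|\nu|=n\}\cong M_d^{\otimes n}$, and $\mathcal{F}_d$ is the norm closure of $\bigcup_n\mathcal{F}_d^n$. A unitary $u\in\mathcal{O}_d$ defines the unital endomorphism $\lambda_u$ of $\mathcal{O}_d$ with $\lambda_u(S_i)=uS_i$. The canonical endomorphism is $\varphi(x)=\sum_iS_ixS_i^*$; it restricts to the shift $x\mapsto1\otimes x$ on $\mathcal{F}_d\cong M_d\otimes M_d\otimes\cdots$, and $\varphi=\lambda_F$ with $F=\sum_{i,j}S_iS_jS_i^*S_j^*$ the tensor flip.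 An R-matrix of dimension $d$ is a unitary $R$ on $\mathbb{C}^d\otimes\mathbb{C}^d$ with $(R\otimes1)(1\otimes R)(R\otimes1)=(1\otimes R)(R\otimes1)(1\otimes R)$; via $M_d\otimes M_d\cong\mathcal{F}_d^2$ it is a unitary in $\mathcal{F}_d^2$ with $R\varphi(R)R=\varphi(R)R\varphi(R)$. $\mathcal{R}(d)$ is the set of all these. $\tau$ is the normalized trace on $\mathcal{F}_d$, $E^0(x)=\frac1{2\pi}\int_0^{2\pi}\lambda_{e^{it}1}(x)\,dt$, $\omega=\tau\circ E^0$, $\mathcal{M}=\pi_\omega(\mathcal{O}_d)''$, $\mathcal{N}=\pi_\omega(\mathcal{F}_d)''$ ($\pi_\omega$ the faithful GNS representation, suppressed in notation). For unitary $u\in\mathcal{F}_d$, $\lambda_u$ extends to a normal $\omega$-preserving endomorphism of $\mathcal{M}$. $\phi_R:\mathcal{M}\to\mathcal{M}$ is the $\omega$-preserving left inverse of $\lambda_R$: the normal unital completely positive map such that $\lambda_R\circ\phi_R$ is the unique $\omega$-preserving conditional expectation $\mathcal{M}\to\lambda_R(\mathcal{M})$. In particular $\phi_F(x)=\frac1d\sum_kS_k^*xS_k$, so in matrix notation $\phi_F(R)=d^{-1}(\mathrm{Tr}\otimes\mathrm{id})(R)$ and $\phi_F(FRF)=d^{-1}(\mathrm{id}\otimes\mathrm{Tr})(R)$. $\mathcal{L}_R\subset\mathcal{N}$ is the von Neumann algebra generated by $\{\varphi^k(R):k\ge0\}$. $R\sim S$ means: there is an isomorphism of von Neumann algebras $\gamma:\mathcal{L}_R\to\mathcal{L}_S$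 with $\gamma(R)=S$ and $\varphi(\gamma(x))=\gamma(\varphi(x))$ for all $x\in\mathcal{L}_R$. *)

(* Defs.v *)
From HB Require Import structures.
From mathcomp Require Import all_boot all_order all_algebra.
From mathcomp Require Import ring lra.
From mathcomp Require Import complex mxtens.
From mathcomp Require Import all_classical all_reals all_analysis.

Set Implicit Arguments.
Unset Strict Implicit.
Unset Printing Implicit Defensive.

Import Order.TTheory GRing.Theory Num.Theory.
Import numFieldNormedType.Exports.
Local Open Scope classical_set_scope.
Local Open Scope complex_scope.
Local Open Scope ring_scope.


(* The inner product is linear in its second argument.  The norm is spelled out
   in the completeness axiom because [hnorm] is only defined below. *)
HB.mixin Record isHilbert (K : realType) H of GRing.Lmodule K[i] H := {
  hdot : H -> H -> K[i];
  hdotP : forall (x y z : H) (a : K[i]),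
    hdot x (a *: y + z) = a * hdot x y + hdot x z;
  hdotC : forall x y : H, hdot y x = Num.conj (hdot x y);
  hdot_ge0 : forall x : H, 0 <= hdot x x;
  hdot_eq0 : forall x : H, hdot x x = 0 -> x = 0;
  hilbert_complete : forall u : nat -> H,
    (forall e : K, 0 < e -> exists N : nat, forall m n : nat,
        (N <= m)%N -> (N <= n)%N ->
        Num.sqrt (complex.Re (hdot (u m - u n) (u m - u n))) < e) ->
    exists l : H, forall e : K, 0 < e -> exists N : nat, forall n : nat,
        (N <= n)%N -> Num.sqrt (complex.Re (hdot (u n - l) (u n - l))) < e
}.

#[short(type="hilbertType")]
HB.structure Definition Hilbert (K : realType) :=
  {H of isHilbert K H & GRing.Lmodule K[i] H}.

Definition hnorm (K : realType) (H : hilbertType K) (x : H) : K :=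
  Num.sqrt (complex.Re (hdot x x)).

Section HilbertTheory.
Variables (K : realType) (H : hilbertType K).
Implicit Types (x y z : H) (a : K[i]).

Lemma hdotDr x y z : hdot x (y + z) = hdot x y + hdot x z.
Proof. by have := hdotP x y z 1; rewrite scale1r mul1r. Qed.

Lemma hdot0r x : hdot x 0 = 0.
Proof. by apply: (@addrI _ (hdot x 0)); rewrite -hdotDr !addr0. Qed.

Lemma hdotZr x y a : hdot x (a *: y) = a * hdot x y.
Proof. by have := hdotP x y 0 a; rewrite !addr0 hdot0r addr0. Qed.

Lemma hdotNr x y : hdot x (- y) = - hdot x y.
Proof. by rewrite -scaleN1r hdotZr mulN1r. Qed.

Lemma hdotDl x y z : hdot (x + y) z = hdot x z + hdot y z.
Proof. by rewrite hdotC hdotDr rmorphD /= -!hdotC. Qed.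

Lemma hdotZl x y a : hdot (a *: x) y = Num.conj a * hdot x y.
Proof. by rewrite hdotC hdotZr rmorphM /= -!hdotC. Qed.

Lemma hdotNl x y : hdot (- x) y = - hdot x y.
Proof. by rewrite hdotC hdotNr rmorphN /= -!hdotC. Qed.

Lemma hdot0l x : hdot 0 x = 0.
Proof. by rewrite hdotC hdot0r conjC0. Qed.

Lemma hdot_extl x y : (forall z, hdot x z = hdot y z) -> x = y.
Proof.
move=> xy; apply/eqP; rewrite -subr_eq0; apply/eqP/hdot_eq0.
by rewrite hdotDl hdotNl xy subrr.
Qed.

Lemma hdot_hnorm x : hdot x x = ((hnorm x) ^+ 2)%:C.
Proof.
have := hdot_ge0 x; rewrite /hnorm; case: (hdot x x) => r s.
rewrite lecE /= => /andP[/eqP s0 r0]; rewrite sqr_sqrtr //.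
by rewrite s0.
Qed.

Lemma hnorm_ge0 x : 0 <= hnorm x.
Proof. exact: sqrtr_ge0. Qed.

Lemma hnorm_eq0 x : hnorm x = 0 -> x = 0.
Proof. by move=> x0; apply: hdot_eq0; rewrite hdot_hnorm x0 expr0n. Qed.

Lemma hnorm0 : hnorm (0 : H) = 0.
Proof. by rewrite /hnorm hdot0l /= sqrtr0. Qed.

Lemma cauchy_schwarz x y : complex.Re (hdot x y) <= hnorm x * hnorm y.
Proof.
have Cinj (r s : K) : (r <= s) = (r%:C <= s%:C :> K[i]) by rewrite lecR.
have key (a b : K) :
    a * b * complex.Re (hdot x y) *+ 2 <= a ^+ 2 * hnorm x ^+ 2 + b ^+ 2 * hnorm y ^+ 2.
  have := hdot_ge0 (a%:C *: x - b%:C *: y).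
  rewrite !(hdotDl, hdotDr, hdotNl, hdotNr, hdotZl, hdotZr) !hdot_hnorm.
  rewrite [hdot y x]hdotC; case: (hdot x y) => r s.
  rewrite lecE /= => /andP[_].
  rewrite !(mul0r, mulr0, subr0, addr0, oppr0, sub0r, mulNr, mulrN, opprK).
  rewrite ?(add0r, addr0, mul0r, mulr0, subr0).
  by move=> h; rewrite -subr_ge0; apply: le_trans h _;
     rewrite le_eqVlt; apply/orP; left; apply/eqP; ring.
case: (eqVneq (hnorm x) 0) => [x0|x0].
  by rewrite (hnorm_eq0 x0) hdot0l hnorm0 mul0r.
case: (eqVneq (hnorm y) 0) => [y0|y0].
  by rewrite (hnorm_eq0 y0) hdot0r hnorm0 mulr0.
have xy0 : 0 < hnorm x * hnorm y by rewrite mulr_gt0 // lt_def ?x0 ?y0 hnorm_ge0.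
have := key (hnorm y) (hnorm x).
rewrite (mulrC (hnorm y ^+ 2)) -mulr2n lerMn2r /= mulrC -exprMn expr2.
by rewrite [hnorm y * _]mulrC ler_pM2r.
Qed.

Lemma hnormD x y : hnorm (x + y) <= hnorm x + hnorm y.
Proof.
rewrite -(@ler_pXn2r _ 2) ?nnegrE ?addr_ge0 ?hnorm_ge0 //.
rewrite [leLHS]sqr_sqrtr; last by have := hdot_ge0 (x + y); rewrite lecE => /andP[].
rewrite !(hdotDl, hdotDr) !hdot_hnorm [hdot y x]hdotC sqrrD.
have := cauchy_schwarz x y; case: (hdot x y) => r s /= rxy.
by lra.
Qed.

Lemma hnormZ a : exists2 c : K, 0 <= c & forall x, hnorm (a *: x) = c * hnorm x.
Proof.
exists (complex.Re `|a|); first by have := normr_ge0 a; rewrite lecE => /andP[].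
move=> z; apply/eqP; rewrite -(@eqrXn2 _ 2) ?mulr_ge0 ?hnorm_ge0 //; last first.
  by have := normr_ge0 a; rewrite lecE => /andP[].
apply/eqP/complexI; rewrite -hdot_hnorm hdotZl hdotZr mulrA.
rewrite [Num.conj a * a]mulrC -normCK hdot_hnorm exprMn rmorphM /=.
by rewrite -[`|a|]/((Normc.normc a)%:C) !expr2 !rmorphM.
Qed.

End HilbertTheory.


Section BoundedOperators.
Variables (K : realType) (H : hilbertType K).

(* A bounded operator is stored together with its adjoint: on a Hilbert space
   the adjoint exists and is uniquely determined (Riesz), so that [bop H] is
   the algebra of all bounded operators on [H]. *)
Record bop := Bop {
  bop_fun :> H -> H;
  bop_adj : H -> H;
  bop_linear : forall (a : K[i]) (x y : H),
    bop_fun (a *: x + y) = a *: bop_fun x + bop_fun y;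
  bop_bounded : exists2 c : K, 0 <= c & forall x, hnorm (bop_fun x) <= c * hnorm x;
  bop_adjP : forall x y : H, hdot x (bop_fun y) = hdot (bop_adj x) y
}.

Implicit Types (s t u : bop).

Lemma bopP s t : (forall x, s x = t x) -> s = t.
Proof.
case: s => f f' fl fb fa; case: t => g g' gl gb ga /= fg.
have {fg} efg : f = g by apply/funext.
subst g.
have efg' : f' = g'.
  by apply/funext => x; apply: hdot_extl => z; rewrite -fa -ga.
by subst g'; congr Bop; exact: Prop_irrelevance.
Qed.

Lemma bopD t x y : t (x + y) = t x + t y.
Proof. by have := bop_linear t 1 x y; rewrite !scale1r. Qed.

Lemma bop0 t : t 0 = 0.
Proof. by apply: (@addrI _ (t 0)); rewrite -bopD !addr0. Qed.

Lemma bopZ t a x : t (a *: x) = a *: t x.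
Proof. by have := bop_linear t a x 0; rewrite !addr0 bop0 addr0. Qed.

Section Adjoint.
Variable t : bop.

Lemma adj_adjP x y : hdot x (bop_adj t y) = hdot (t x) y.
Proof. by rewrite hdotC -bop_adjP -hdotC. Qed.

Lemma adj_linear (a : K[i]) (x y : H) :
  bop_adj t (a *: x + y) = a *: bop_adj t x + bop_adj t y.
Proof.
apply: hdot_extl => z.
by rewrite -bop_adjP !(hdotDl, hdotZl) -!bop_adjP.
Qed.

Lemma adj_bounded :
  exists2 c : K, 0 <= c & forall x, hnorm (bop_adj t x) <= c * hnorm x.
Proof.
have [c c0 tc] := bop_bounded t; exists c => // x.
set y := bop_adj t x.
have [->|y0] := eqVneq (hnorm y) 0; first by rewrite mulr_ge0 ?hnorm_ge0.
have yp : 0 < hnorm y by rewrite lt_def y0 hnorm_ge0.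
rewrite -(ler_pM2r yp) -expr2.
have -> : hnorm y ^+ 2 = complex.Re (hdot x (t y)).
  by rewrite bop_adjP -/y hdot_hnorm.
apply: le_trans (cauchy_schwarz _ _) _.
rewrite [c * _]mulrC -mulrA ler_wpM2l ?hnorm_ge0 //.
Qed.

Definition adj := Bop adj_linear adj_bounded adj_adjP.
End Adjoint.

Lemma bop_zero_subproof : exists2 c : K, 0 <= c & forall x : H, hnorm (0 : H) <= c * hnorm x.
Proof. by exists 0 => // x; rewrite hnorm0 mul0r. Qed.

Definition bop_zero : bop.
Proof.
refine (@Bop (fun=> 0) (fun=> 0) _ bop_zero_subproof _).
- by move=> a x y; rewrite scaler0 addr0.
- by move=> x y; rewrite hdot0r hdot0l.
Defined.

Definition bop_one : bop.
Proof.
refine (@Bop id id _ _ _) => //.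
by exists 1 => // x; rewrite mul1r.
Defined.

Definition bop_scale (a : K[i]) (t : bop) : bop.
Proof.
refine (@Bop (fun x => a *: t x) (fun x => Num.conj a *: bop_adj t x) _ _ _).
- by move=> b x y; rewrite bop_linear scalerDr !scalerA mulrC.
- have [c c0 tc] := bop_bounded t; have [r r0 ra] := hnormZ H a.
  exists (r * c) => [|x]; first exact: mulr_ge0.
  by rewrite ra -mulrA ler_wpM2l.
- by move=> x y; rewrite hdotZr hdotZl conjCK bop_adjP.
Defined.

Definition bop_add (s t : bop) : bop.
Proof.
refine (@Bop (fun x => s x + t x) (fun x => bop_adj s x + bop_adj t x) _ _ _).
- by move=> a x y; rewrite !bop_linear scalerDr addrACA.
- have [c c0 sc] := bop_bounded s; have [b b0 tb] := bop_bounded t.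
  exists (c + b) => [|x]; first exact: addr_ge0.
  by rewrite (le_trans (hnormD _ _)) // mulrDl lerD.
- by move=> x y; rewrite hdotDr hdotDl !bop_adjP.
Defined.

Definition bop_mul (s t : bop) : bop.
Proof.
refine (@Bop (fun x => s (t x)) (fun x => bop_adj t (bop_adj s x)) _ _ _).
- by move=> a x y; rewrite !bop_linear.
- have [c c0 sc] := bop_bounded s; have [b b0 tb] := bop_bounded t.
  exists (c * b) => [|x]; first exact: mulr_ge0.
  by rewrite (le_trans (sc _)) // -mulrA ler_wpM2l.
- by move=> x y; rewrite !bop_adjP.
Defined.

HB.instance Definition _ := gen_eqMixin bop.
HB.instance Definition _ := gen_choiceMixin bop.

Let bop_addA : associative bop_add.
Proof. by move=> s t u; apply: bopP => x /=; rewrite addrA. Qed.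
Let bop_addC : commutative bop_add.
Proof. by move=> s t; apply: bopP => x /=; rewrite addrC. Qed.
Let bop_add0 : left_id bop_zero bop_add.
Proof. by move=> s; apply: bopP => x /=; rewrite add0r. Qed.
Let bop_addN : left_inverse bop_zero (bop_scale (-1)) bop_add.
Proof. by move=> s; apply: bopP => x /=; rewrite scaleN1r addNr. Qed.

HB.instance Definition _ :=
  GRing.isZmodule.Build bop bop_addA bop_addC bop_add0 bop_addN.

Let bop_mulA : associative bop_mul.
Proof. by move=> s t u; apply: bopP. Qed.
Let bop_mul1l : left_id bop_one bop_mul.
Proof. by move=> s; apply: bopP. Qed.
Let bop_mul1r : right_id bop_one bop_mul.
Proof. by move=> s; apply: bopP. Qed.
Let bop_mulDl : left_distributive bop_mul bop_add.
Proof. by move=> s t u; apply: bopP. Qed.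
Let bop_mulDr : right_distributive bop_mul bop_add.
Proof. by move=> s t u; apply: bopP => x /=; rewrite bopD. Qed.

HB.instance Definition _ := GRing.Zmodule_isPzRing.Build bop
  bop_mulA bop_mul1l bop_mul1r bop_mulDl bop_mulDr.

Let bop_scaleA a b t : bop_scale a (bop_scale b t) = bop_scale (a * b) t.
Proof. by apply: bopP => x /=; rewrite scalerA. Qed.
Let bop_scale1 : left_id 1 bop_scale.
Proof. by move=> t; apply: bopP => x /=; rewrite scale1r. Qed.
Let bop_scaleDr : right_distributive bop_scale +%R.
Proof. by move=> a s t; apply: bopP => x /=; rewrite scalerDr. Qed.
Let bop_scaleDl t : {morph bop_scale^~ t : a b / a + b}.
Proof. by move=> a b; apply: bopP => x /=; rewrite scalerDl. Qed.

HB.instance Definition _ := GRing.Zmodule_isLmodule.Build K[i] bop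
  bop_scaleA bop_scale1 bop_scaleDr bop_scaleDl.

Definition opnorm t : K := sup [set hnorm (t x) | x in [set x : H | hnorm x <= 1]].

Definition unitary_op t := adj t * t = 1 /\ t * adj t = 1.

Definition normal_op t := adj t * t = t * adj t.

Definition positive_op t := forall x : H, 0 <= hdot x (t x).

End BoundedOperators.

Arguments bop {K} H.


Section OperatorAlgebras.
Variables (K : realType) (H : hilbertType K).
Implicit Types (A B : set (bop H)) (T f : bop H -> bop H).

Definition star_subalgebra A :=
  [/\ A 1, forall (a : K[i]) x y, A x -> A y -> A (a *: x + y),
      forall x y, A x -> A y -> A (x * y) & forall x, A x -> A (adj x)].

Definition norm_closure A : set (bop H) :=
  [set x | forall e : K, 0 < e -> exists2 y, A y & opnorm (x - y) < e].

Definition cstar_generated A : set (bop H) :=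
  [set x | forall B, star_subalgebra B -> norm_closure B `<=` B -> A `<=` B -> B x].

Definition commutant A : set (bop H) :=
  [set x | forall y, A y -> x * y = y * x].

Definition bicommutant A := commutant (commutant A).

Definition vN_generated A := bicommutant (A `|` [set adj x | x in A]).

(* Maps between operator algebras are total functions on [bop H], of which
   only the restriction to the domain [A] matters. *)

Definition linear_on A T :=
  forall (a : K[i]) x y, A x -> A y -> T (a *: x + y) = a *: T x + T y.

Definition maps_to A B T := forall x, A x -> B (T x).

Definition star_hom A B T :=
  [/\ maps_to A B T, linear_on A T, T 1 = 1,
      forall x y, A x -> A y -> T (x * y) = T x * T y
    & forall x, A x -> T (adj x) = adj (T x)].

(* The ultraweakly continuous functionals x |-> sum_k <xi_k, x eta_k>. *)
Definition sq_summable (xi : nat -> H) :=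
  exists c : K, forall n, \sum_(k < n) hnorm (xi k) ^+ 2 <= c.

Definition normal_functional A (g : bop H -> K[i]) :=
  exists xi eta : nat -> H, [/\ sq_summable xi, sq_summable eta &
    forall x, A x -> forall e : K, 0 < e -> exists N : nat, forall n : nat, (N <= n)%N ->
      `|\sum_(k < n) hdot (xi k) (x (eta k)) - g x| < e%:C].

(* Ultraweak continuity of a linear map A -> B: pulling back an ultraweakly
   continuous functional gives an ultraweakly continuous functional. *)
Definition normal_map A B T :=
  forall g, normal_functional B g -> normal_functional A (g \o T).

(* Normality is automatic for a bijective star-homomorphism between von Neumann
   algebras. *)
Definition vN_isomorphism A B T :=
  [/\ star_hom A B T, set_bij A B T & normal_map A B T].

(* Positivity in M_n(B(H)), acting on H^n. *)
Definition positive_mx n (x : 'I_n -> 'I_n -> bop H) :=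
  forall xi : 'I_n -> H, 0 <= \sum_i \sum_j hdot (xi i) (x i j (xi j)).

Definition completely_positive A T :=
  forall n (x : 'I_n -> 'I_n -> bop H), (forall i j, A (x i j)) ->
    positive_mx x -> positive_mx (fun i j => T (x i j)).

Definition conditional_expectation A B E :=
  [/\ maps_to A B E, linear_on A E, forall b, B b -> E b = b,
      forall b x c, B b -> A x -> B c -> E (b * x * c) = b * E x * c
    & forall x, A x -> positive_op x -> positive_op (E x)].

Definition tracial_state A (tau : bop H -> K[i]) :=
  [/\ forall (a : K[i]) x y, A x -> A y -> tau (a *: x + y) = a * tau x + tau y,
      tau 1 = 1, forall x, A x -> 0 <= tau (adj x * x)
    & forall x y, A x -> A y -> tau (x * y) = tau (y * x)].

End OperatorAlgebras.


Section Cuntz.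
Variables (K : realType) (H : hilbertType K) (d : nat) (S : 'I_d -> bop H).

Definition cuntz_relations :=
  (forall i j, adj (S i) * S j = (i == j)%:R) /\ \sum_i S i * adj (S i) = 1.

Definition cuntz_algebra : set (bop H) := cstar_generated (range S).

Definition word (mu : seq 'I_d) : bop H := \prod_(i <- mu) S i.

Definition Fn (n : nat) : set (bop H) :=
  [set x | exists c : n.-tuple 'I_d -> n.-tuple 'I_d -> K[i],
     x = \sum_mu \sum_nu c mu nu *: (word mu * adj (word nu))].

Definition Fd : set (bop H) := norm_closure (\bigcup_n Fn n).

Definition can_endo (x : bop H) : bop H := \sum_i S i * x * adj (S i).

Definition cuntz_flip : bop H := \sum_i \sum_j S i * S j * adj (S i) * adj (S j).

(* [lam] is lambda_u on the algebra [A]. *)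
Definition cuntz_endomorphism (A : set (bop H)) (u : bop H) (lam : bop H -> bop H) :=
  star_hom A A lam /\ forall i, lam (S i) = u * S i.

(* E^0(x) = (2 pi)^-1 * int_0^(2 pi) lambda_(e^(i t) 1)(x) dt, as a weak
   integral; [gauge t] is lambda_(e^(i t) 1). *)
Definition gauge_average (gauge : K -> bop H -> bop H) (x y : bop H) :=
  forall xi eta : H, hdot xi (y eta) =
    ((2 * pi)^-1 * \int[lebesgue_measure]_(t in `[0, 2 * pi]) complex.Re (hdot xi (gauge t x eta)))
    +i* ((2 * pi)^-1 * \int[lebesgue_measure]_(t in `[0, 2 * pi]) complex.Im (hdot xi (gauge t x eta))).

End Cuntz.

(* The GNS representation of O_d with respect to omega = tau o E^0, given by
   the images on H of the generators and the cyclic vector; it is determined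
   up to unitary equivalence. *)
Record cuntz_gns (K : realType) (H : hilbertType K) (d : nat) := CuntzGNS {
  cS : 'I_d -> bop H;
  cS_rel : cuntz_relations cS;
  gns_gauge : K -> bop H -> bop H;
  gns_gaugeP : forall t,
    cuntz_endomorphism cS (cuntz_algebra cS) ((cos t +i* sin t) *: (1 : bop H)) (gns_gauge t);
  gns_E0 : bop H -> bop H;
  gns_E0P : forall x, cuntz_algebra cS x -> gauge_average gns_gauge x (gns_E0 x);
  gns_tau : bop H -> K[i];
  gns_tauP : tracial_state (Fd cS) gns_tau;
  gns_Omega : H;
  gns_omega : forall x, cuntz_algebra cS x -> hdot gns_Omega (x gns_Omega) = gns_tau (gns_E0 x);
  gns_cyclic : forall (xi : H) (e : K), 0 < e ->
    exists2 x, cuntz_algebra cS x & hnorm (x gns_Omega - xi) < e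
}.

Section YangBaxterEndomorphisms.
Variables (K : realType) (H : hilbertType K) (d : nat) (D : cuntz_gns H d).
Local Notation S := (cS D).

Definition M_alg : set (bop H) := bicommutant (cuntz_algebra S).

(* The normal extension of omega to M. *)
Definition omega (x : bop H) : K[i] := hdot (gns_Omega D) (x (gns_Omega D)).

Definition is_lambda (u : bop H) (lam : bop H -> bop H) :=
  [/\ cuntz_endomorphism S M_alg u lam, normal_map M_alg M_alg lam
    & forall x, M_alg x -> omega (lam x) = omega x].

Definition omega_left_inverse (u : bop H) (phi : bop H -> bop H) :=
  exists2 lam, is_lambda u lam &
  [/\ [/\ maps_to M_alg M_alg phi, linear_on M_alg phi, phi 1 = 1,
           normal_map M_alg M_alg phi & completely_positive M_alg phi],
      forall x, M_alg x -> phi (lam x) = x,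
      forall x, M_alg x -> omega (phi x) = omega x,
      conditional_expectation M_alg [set lam x | x in M_alg] (lam \o phi)
    & forall x, M_alg x -> omega (lam (phi x)) = omega x].

Definition L_alg (r : bop H) : set (bop H) :=
  vN_generated [set iter k (can_endo S) r | k in [set: nat]].

Definition yb_equiv (r s : bop H) :=
  exists gam, [/\ vN_isomorphism (L_alg r) (L_alg s) gam, gam r = s
    & forall x, L_alg r x -> can_endo S (gam x) = gam (can_endo S x)].

(* The isomorphism of M_d (x) M_d with F_d^2 sending the matrix unit
   e_(ik) (x) e_(jl) to S_i S_j (S_k S_l)^*. *)
Definition to_F2 (A : 'M[K[i]]_(d * d)) : bop H :=
  \sum_i \sum_j \sum_k \sum_l
    A (mxtens_index (i, j)) (mxtens_index (k, l)) *: (S i * S j * adj (S k * S l)).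

End YangBaxterEndomorphisms.


Section RMatrices.
Variables (K : realType) (d : nat).

Definition yang_baxter (A : 'M[K[i]]_(d * d)) :=
  let A1 : 'M[K[i]]_(d * d * d) := A *t (1%:M : 'M[K[i]]_d) in
  let A2 : 'M[K[i]]_(d * d * d) :=
    castmx (mulnA d d d, mulnA d d d) ((1%:M : 'M[K[i]]_d) *t A) in
  A1 *m A2 *m A1 = A2 *m A1 *m A2.

Definition r_matrix : set 'M[K[i]]_(d * d) :=
  [set A | A \is unitarymx /\ yang_baxter A].

(* (Tr (x) id)(A) *)
Definition ptrace_l (A : 'M[K[i]]_(d * d)) : 'M[K[i]]_d :=
  \matrix_(j, l) \sum_i A (mxtens_index (i, j)) (mxtens_index (i, l)).

(* (id (x) Tr)(A) *)
Definition ptrace_r (A : 'M[K[i]]_(d * d)) : 'M[K[i]]_d :=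
  \matrix_(i, k) \sum_j A (mxtens_index (i, j)) (mxtens_index (k, j)).

End RMatrices.

(* Main.v *)
Require Import Defs.
From mathcomp Require Import all_boot all_order all_algebra.
From mathcomp Require Import fingroup perm.
From mathcomp Require Import ring lra.
From mathcomp Require Import complex mxtens spectral.
From mathcomp Require Import all_classical all_reals all_analysis.

Set Implicit Arguments.
Unset Strict Implicit.
Unset Printing Implicit Defensive.

Import Order.TTheory GRing.Theory Num.Theory.
Import numFieldNormedType.Exports.
Local Open Scope classical_set_scope.
Local Open Scope complex_scope.
Local Open Scope ring_scope.

(** Write [phi] for the shift, [omega] for the vector state and
    [R_n = R phi(R) ... phi^(n-1)(R)]. Everything is computed on polynomials in
    the Cuntz isometries, that is, on the span of the monomials
    [S_mu S_nu^*].

    There [omega] is explicit: averaging over the gauge group kills the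
    monomials with [|mu| <> |nu|], and a trace takes the value [d^-n] on each
    minimal projection of level [n] ([om_monomial]). Consequently [omega] obeys
    the scaling relation [omega(S_i z) = omega(z S_i) / d] ([kms_S]), is a trace
    in gauge degree [0], and is faithful on polynomials ([om_faithful]).

    A left inverse [ph] of [lambda_u] is the adjoint of [lambda_u] for [omega].
    The bimodule property gives
    [omega(a ph(y) b) = omega(lambda_u(a) y lambda_u(b))]; the scaling relation
    brings [a] to the right, and polynomial vectors are dense. So [ph y] is the
    element [t] with [omega(y lambda_u(c)) = omega(t c)] for all polynomials
    [c] ([left_inverse_eq]). For the flip this gives the average of the
    [S_k^* y S_k], a normalised left partial trace ([left_inverse_flip]).

    Let [T] and [L] be the normalised right and left partial traces of [R]. The
    braid relation shows that [R phi(T) R^*] has the same inner product with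
    [T] as [T] itself. Both have the same 2-norm, hence [R phi(T) R^* = T]
    ([right_trace_move]); likewise [R L R^* = phi(L)], and [R^*] satisfies the
    same relations. They yield [<T, L> = |T|^2] and [<L, T> = |L|^2], so that
    [L = T] ([partial_traces_eq]). Taking the left partial trace of
    [R T^* = phi(T)^* R] in two ways shows that [T] is normal
    ([partial_trace_normal]), and as an average of compressions of a unitary it
    is a contraction.

    On words of equal length [lambda_R(c) = R_n c R_n^*]. The braid relations
    turn [R_n^* R R_n] into a conjugate of [phi^(n-1)(R)], whose last leg
    sticks out of the support of [c]; tracing it out produces [phi^(n-1)(T)],
    which the relation above moves back to [T]. Thus
    [omega(R lambda_R(c)) = omega(T c)] and the left inverse maps [R] to [T]
    ([left_inverse_yb]). The same moves reduce [omega(R_n)] to [omega(T^n)]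
    ([om_yb_product_pow]).

    Finally the shift is mixing: [phi^n(x)] tends weakly to the scalar
    [omega(x)] ([mixing_weak]). A normal isomorphism that intertwines the
    shifts and maps [R] to [S] therefore preserves the trace of [R_n]
    ([yb_equiv_om]). By the previous formula the normal matrices [T] of [R] and
    of [S] have the same power traces, hence the same eigenvalues with
    multiplicities, and are unitarily similar ([normal_unitary_similar]). *)

(** * Adjoints and the operator norm *)

Section OperatorCalculus.
Variables (K : realType) (H : hilbertType K).
Implicit Types (x y z : bop H) (a : K[i]) (v w : H).

Lemma bopE_add x y v : (x + y) v = x v + y v. Proof. by []. Qed.
Lemma bopE_mul x y v : (x * y) v = x (y v). Proof. by []. Qed.
Lemma bopE_scale a x v : (a *: x) v = a *: x v. Proof. by []. Qed.
Lemma bopE_one v : (1 : bop H) v = v. Proof. by []. Qed.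
Lemma bopE_zero v : (0 : bop H) v = 0. Proof. by []. Qed.
Lemma bopE_opp x v : (- x) v = - x v. Proof. by rewrite -[- x v]scaleN1r. Qed.

Lemma bop_scaleAl a x y : (a *: x) * y = a *: (x * y).
Proof. exact: bopP. Qed.
Lemma bop_scaleAr a x y : x * (a *: y) = a *: (x * y).
Proof. by apply: bopP => v; rewrite bopE_mul !bopE_scale bopZ. Qed.

Lemma adjK : involutive (@adj K H). Proof. by move=> x; apply: bopP. Qed.
Lemma adjM x y : adj (x * y) = adj y * adj x. Proof. exact: bopP. Qed.
Lemma adjD x y : adj (x + y) = adj x + adj y. Proof. exact: bopP. Qed.
Lemma adjZ a x : adj (a *: x) = Num.conj a *: adj x. Proof. exact: bopP. Qed.
Lemma adj1 : adj (1 : bop H) = 1. Proof. exact: bopP. Qed.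
Lemma adj0 : adj (0 : bop H) = 0. Proof. exact: bopP. Qed.
Lemma adjN x : adj (- x) = - adj x.
Proof. by apply/eqP; rewrite -addr_eq0 -adjD addNr adj0. Qed.
Lemma adjB x y : adj (x - y) = adj x - adj y.
Proof. by rewrite adjD adjN. Qed.
Lemma adj_sum (I : Type) (r : seq I) (P : pred I) (F : I -> bop H) :
  adj (\sum_(i <- r | P i) F i) = \sum_(i <- r | P i) adj (F i).
Proof. exact: (big_morph _ adjD adj0). Qed.

Lemma hdot_adj x v w : hdot v (x w) = hdot (adj x v) w.
Proof. exact: bop_adjP. Qed.
Lemma hdot_adjr x v w : hdot (x v) w = hdot v (adj x w).
Proof. by rewrite hdot_adj adjK. Qed.

Lemma bop_ext_dot x y : (forall v w, hdot v (x w) = hdot v (y w)) -> x = y.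
Proof.
move=> xy; apply: bopP => w; apply: hdot_extl => v.
by rewrite hdotC xy -hdotC.
Qed.

Lemma hnorm_gt0_inv v : v != 0 -> 0 < hnorm v.
Proof.
move=> v0; rewrite lt_def hnorm_ge0 andbT; apply: contraNneq v0.
by move=> /hnorm_eq0 ->.
Qed.

Lemma hnormZR (r : K) v : 0 <= r -> hnorm (r%:C *: v) = r * hnorm v.
Proof.
move=> r0; apply/eqP; rewrite -(@eqrXn2 _ 2) ?mulr_ge0 ?hnorm_ge0 //.
apply/eqP/complexI; rewrite -hdot_hnorm hdotZl hdotZr hdot_hnorm mulrA.
have -> : Num.conj r%:C = r%:C :> K[i] by exact: conjc_real.
by rewrite exprMn !expr2 !rmorphM.
Qed.

Lemma hnormN v : hnorm (- v) = hnorm v.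
Proof. by rewrite /hnorm hdotNl hdotNr opprK. Qed.

Lemma hnormBC v w : hnorm (v - w) = hnorm (w - v).
Proof. by rewrite -hnormN opprB. Qed.

(** A bounded operator has finite operator norm, so the supremum defining it is
    an upper bound on the unit ball; the rest is homogeneity. *)
Lemma opnorm_bound x v : hnorm (x v) <= opnorm x * hnorm v.
Proof.
have [->|v0] := eqVneq v 0; first by rewrite bop0 hnorm0 mulr0.
have vp := hnorm_gt0_inv v0; set r := (hnorm v)^-1.
have r0 : 0 <= r by rewrite invr_ge0 ltW.
have : hnorm (x (r%:C *: v)) <= opnorm x.
  apply: ub_le_sup.
    have [c c0 xc] := bop_bounded x; exists c => _ [w /= w1 <-].
    by apply: le_trans (xc w) _; rewrite -[leRHS]mulr1 ler_wpM2l.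
  by exists (r%:C *: v) => //=; rewrite hnormZR // mulVf // gt_eqF.
by rewrite bopZ hnormZR // mulrC ler_pdivrMr.
Qed.

Lemma opnorm_ge0 x : 0 <= opnorm x.
Proof.
apply: ub_le_sup; last by exists 0; rewrite /= ?hnorm0 ?bop0 ?hnorm0.
have [c c0 xc] := bop_bounded x; exists c => _ [w /= w1 <-].
by apply: le_trans (xc w) _; rewrite -[leRHS]mulr1 ler_wpM2l.
Qed.

Lemma opnorm_le x (c : K) :
  0 <= c -> (forall v, hnorm (x v) <= c * hnorm v) -> opnorm x <= c.
Proof.
move=> c0 xc; apply: ge_sup.
  by exists (hnorm (x 0)); exists 0; rewrite //= hnorm0.
by move=> _ [w /= w1 <-]; apply: le_trans (xc w) _; rewrite -[leRHS]mulr1 ler_wpM2l.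
Qed.

(** Cauchy-Schwarz applied to [|x^* v|^2 = <v, x x^* v>]. *)
Lemma hnorm_adj_bound x v : hnorm (adj x v) <= opnorm x * hnorm v.
Proof.
have [->|y0] := eqVneq (hnorm (adj x v)) 0.
  by rewrite mulr_ge0 ?opnorm_ge0 ?hnorm_ge0.
have yp : 0 < hnorm (adj x v) by rewrite lt_def y0 hnorm_ge0.
rewrite -(ler_pM2r yp) -expr2.
have -> : hnorm (adj x v) ^+ 2 = complex.Re (hdot v (x (adj x v))).
  by rewrite hdot_adj hdot_hnorm.
apply: le_trans (cauchy_schwarz _ _) _.
by rewrite mulrAC [leRHS]mulrC ler_wpM2l ?hnorm_ge0 // opnorm_bound.
Qed.

Lemma hnorm_isometry x v : adj x * x = 1 -> hnorm (x v) = hnorm v.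
Proof. by move=> x1; rewrite /hnorm hdot_adj -bopE_mul x1. Qed.

Lemma hnorm_coisometry x v : adj x * x = 1 -> hnorm (adj x v) <= hnorm v.
Proof.
move=> x1; apply: le_trans (hnorm_adj_bound _ _) _.
rewrite -[leRHS]mul1r ler_wpM2r ?hnorm_ge0 //.
by apply: opnorm_le => // w; rewrite mul1r hnorm_isometry.
Qed.

End OperatorCalculus.

(** * Monomials in the Cuntz isometries *)

Section LinearSpan.
Variables (K : realType) (H : hilbertType K).
Implicit Types (A B C : set (bop H)) (x y : bop H).

(** Given inductively, so that a linear property of the span is proved by
    induction from the spanning set. *)
Inductive lspan A : bop H -> Prop :=
| lspan_base x : A x -> lspan A x
| lspan0 : lspan A 0
| lspan_lin (a : K[i]) x y : lspan A x -> lspan A y -> lspan A (a *: x + y).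

Lemma lspanD A x y : lspan A x -> lspan A y -> lspan A (x + y).
Proof. by move=> xA yA; rewrite -[x]scale1r; apply: lspan_lin. Qed.

Lemma lspanZ A a x : lspan A x -> lspan A (a *: x).
Proof. by move=> xA; rewrite -[_ *: _]addr0; apply: lspan_lin => //; apply: lspan0. Qed.

Lemma lspanB A x y : lspan A x -> lspan A y -> lspan A (x - y).
Proof. by move=> xA yA; rewrite -scaleN1r addrC; apply: lspan_lin. Qed.

Lemma lspanMn A x n : lspan A x -> lspan A (x *+ n).
Proof.
move=> xA; elim: n => [|n IH]; first by rewrite mulr0n; apply: lspan0.
by rewrite mulrS; apply: lspanD.
Qed.

Lemma lspan_sum A (I : Type) (r : seq I) (P : pred I) (F : I -> bop H) :
  (forall i, P i -> lspan A (F i)) -> lspan A (\sum_(i <- r | P i) F i).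
Proof. by move=> FA; apply: big_ind => //; [exact: lspan0 | exact: lspanD]. Qed.

Lemma lspan_map A B (T : bop H -> bop H) :
    (forall a x y, T (a *: x + y) = a *: T x + T y) ->
    (forall x, A x -> lspan B (T x)) -> forall x, lspan A x -> lspan B (T x).
Proof.
move=> Tl AB x; elim=> {x} [x /AB //||a x y _ IHx _ IHy].
  have T0 : T 0 = 0.
    by have := Tl (-1) 0 0; rewrite scaler0 addr0 scaleN1r addNr.
  by rewrite T0; apply: lspan0.
by rewrite Tl; apply: lspan_lin.
Qed.

Lemma lspan_mulr A B y : (forall x, A x -> lspan B (x * y)) ->
  forall x, lspan A x -> lspan B (x * y).
Proof. by apply: lspan_map => a x z; rewrite mulrDl bop_scaleAl. Qed.

Lemma lspan_mull A B y : (forall x, A x -> lspan B (y * x)) ->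
  forall x, lspan A x -> lspan B (y * x).
Proof. by apply: lspan_map => a x z; rewrite mulrDr bop_scaleAr. Qed.

Lemma lspan_adj A B : (forall x, A x -> lspan B (adj x)) ->
  forall x, lspan A x -> lspan B (adj x).
Proof.
move=> AB x; elim=> {x} [x /AB //||a x y _ IHx _ IHy]; first by rewrite adj0; apply: lspan0.
by rewrite adjD adjZ; apply: lspan_lin.
Qed.

End LinearSpan.

Section CuntzMonomials.
Variables (K : realType) (H : hilbertType K) (d : nat) (S : 'I_d -> bop H).
Hypothesis HS : cuntz_relations S.
Local Notation phi := (can_endo S).
Local Notation word := (word S).
Implicit Types (mu nu : seq 'I_d) (x y z : bop H).

Definition monomial mu nu : bop H := word mu * adj (word nu).

Definition pol : set (bop H) :=
  lspan [set x | exists mu nu, x = monomial mu nu].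

(** The span of the monomials [S_mu S_nu^*] with [|mu| = m] and [|nu| = n];
    thus [hom n n] is the matrix algebra [F_d^n], and [hom m n] lies in gauge
    degree [m - n]. *)
Definition hom m n : set (bop H) :=
  lspan [set x | exists mu nu, [/\ size mu = m, size nu = n & x = monomial mu nu]].

Lemma adjSS i j : adj (S i) * S j = (i == j)%:R. Proof. exact: HS.1. Qed.
Lemma sum_SS : \sum_i S i * adj (S i) = 1. Proof. exact: HS.2. Qed.

Lemma word_nil : word [::] = 1. Proof. exact: big_nil. Qed.
Lemma word_cons i mu : word (i :: mu) = S i * word mu.
Proof. exact: big_cons. Qed.
Lemma word_cat mu nu : word (mu ++ nu) = word mu * word nu.
Proof. exact: big_cat. Qed.
Lemma word_rcons mu i : word (rcons mu i) = word mu * S i.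
Proof. by rewrite -cats1 word_cat word_cons word_nil mulr1. Qed.
Lemma word1 i : word [:: i] = S i.
Proof. by rewrite word_cons word_nil mulr1. Qed.

Lemma adjS_word i j mu : adj (S i) * word (j :: mu) = word mu *+ (i == j).
Proof. by rewrite word_cons mulrA adjSS mulr_natl. Qed.

Lemma adj_word_word mu nu : size mu = size nu ->
  adj (word mu) * word nu = (mu == nu)%:R.
Proof.
elim: mu nu => [|i mu IH] [|j nu] //= sz; first by rewrite word_nil adj1 mulr1.
case: sz => sz.
rewrite word_cons adjM -mulrA adjS_word mulrnAr IH // eqseq_cons.
by case: (i == j); rewrite ?mulr1n ?mulr0n.
Qed.

Lemma monomial_cons i j mu nu :
  monomial (i :: mu) (j :: nu) = S i * monomial mu nu * adj (S j).
Proof. by rewrite /monomial !word_cons adjM !mulrA. Qed.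

Lemma adj_monomial mu nu : adj (monomial mu nu) = monomial nu mu.
Proof. by rewrite /monomial adjM adjK. Qed.

Lemma pol_monomial mu nu : pol (monomial mu nu).
Proof. by apply: lspan_base; exists mu, nu. Qed.

Lemma hom_monomial mu nu : hom (size mu) (size nu) (monomial mu nu).
Proof. by apply: lspan_base; exists mu, nu. Qed.

Lemma hom_pol m n x : hom m n x -> pol x.
Proof.
move=> hx; rewrite -[x]mulr1; move: x hx; apply: lspan_mulr => _ [mu [nu [_ _ ->]]].
by rewrite mulr1; apply: pol_monomial.
Qed.

Lemma pol_adj x : pol x -> pol (adj x).
Proof.
by apply: lspan_adj => _ [mu [nu ->]]; rewrite adj_monomial; apply: pol_monomial.
Qed.

Lemma hom_adj m n x : hom m n x -> hom n m (adj x).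
Proof.
apply: lspan_adj => _ [mu [nu [<- <- ->]]].
by rewrite adj_monomial; apply: hom_monomial.
Qed.

Lemma pol1 : pol 1.
Proof. by have := pol_monomial [::] [::]; rewrite /monomial word_nil adj1 mulr1. Qed.

Lemma polB x y : pol x -> pol y -> pol (x - y). Proof. exact: lspanB. Qed.

Lemma homB m n x y : hom m n x -> hom m n y -> hom m n (x - y).
Proof. exact: lspanB. Qed.

Lemma hom_one : hom 0 0 1.
Proof. by have := hom_monomial [::] [::]; rewrite /monomial word_nil adj1 mulr1. Qed.

Lemma pol_S i : pol (S i).
Proof. by have := pol_monomial [:: i] [::]; rewrite /monomial word1 word_nil adj1 mulr1. Qed.

Lemma hom_S_mul i m n x : hom m n x -> hom m.+1 n (S i * x).
Proof.
apply: lspan_mull => _ [mu [nu [<- <- ->]]].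
by rewrite /monomial mulrA -word_cons; apply: (hom_monomial (i :: mu)).
Qed.

Lemma hom_adjS_mul i m n x : hom m.+1 n x -> hom m n (adj (S i) * x).
Proof.
apply: lspan_mull => _ [[|j mu] [nu [//= [<-] <- ->]]].
rewrite /monomial mulrA adjS_word mulrnAl; apply: lspanMn.
exact: hom_monomial.
Qed.

Lemma pol_S_mul i x : pol x -> pol (S i * x).
Proof.
apply: lspan_mull => _ [mu [nu ->]].
by rewrite /monomial mulrA -word_cons; apply: pol_monomial.
Qed.

Lemma pol_adjS_mul i x : pol x -> pol (adj (S i) * x).
Proof.
apply: lspan_mull => _ [[|j mu] [nu ->]].
  rewrite /monomial word_nil mul1r -adjM -word_rcons.
  by have := pol_monomial [::] (rcons nu i); rewrite /monomial word_nil mul1r.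
rewrite /monomial mulrA adjS_word mulrnAl; apply: lspanMn.
exact: pol_monomial.
Qed.

Lemma hom_word_mul mu m n x : hom m n x -> hom (size mu + m) n (word mu * x).
Proof.
move=> hx; elim: mu => [|i mu IH]; first by rewrite word_nil mul1r.
by rewrite word_cons -mulrA; apply: hom_S_mul.
Qed.

Lemma hom_adj_word_mul nu m n x :
  hom (size nu + m) n x -> hom m n (adj (word nu) * x).
Proof.
elim: nu m x => [|i nu IH] m x hx; first by rewrite word_nil adj1 mul1r.
by rewrite word_cons adjM -mulrA; apply: IH; apply: hom_adjS_mul.
Qed.

Lemma hom_mul m n k x y : hom m n x -> hom n k y -> hom m k (x * y).
Proof.
move=> hx hy; move: x hx; apply: lspan_mulr => _ [mu [nu [<- szn ->]]].
rewrite /monomial -mulrA -[size mu]addn0; apply: hom_word_mul.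
by apply: hom_adj_word_mul; rewrite addn0 szn.
Qed.

Lemma pol_mul x y : pol x -> pol y -> pol (x * y).
Proof.
move=> hx hy; move: x hx; apply: lspan_mulr => _ [mu [nu ->]].
rewrite /monomial -mulrA; elim: mu => [|i mu IH]; last first.
  by rewrite word_cons -mulrA; apply: pol_S_mul.
rewrite word_nil mul1r; elim: nu y hy => [|i nu IH] y hy.
  by rewrite word_nil adj1 mul1r.
by rewrite word_cons adjM -mulrA; apply: IH; apply: pol_adjS_mul.
Qed.

(** Inserting [1 = sum_i S_i S_i^*] in the middle of a monomial. *)
Lemma hom_lift m n x : hom m n x -> hom m.+1 n.+1 x.
Proof.
move=> hx; rewrite -[x]mulr1; move: x hx; apply: lspan_mulr => _ [mu [nu [<- <- ->]]].
rewrite mulr1 /monomial -[word mu]mulr1 -sum_SS mulr_sumr mulr_suml.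
apply: lspan_sum => i _; rewrite mulrA -word_rcons -mulrA -adjM -word_rcons.
by have := hom_monomial (rcons mu i) (rcons nu i); rewrite !size_rcons.
Qed.

Lemma hom_exp m x n : hom m m x -> hom m m (x ^+ n).
Proof.
move=> hx; elim: n => [|n IH]; last by rewrite exprS; apply: hom_mul hx IH.
rewrite expr0; elim: m {hx} => [|m IH]; [exact: hom_one | exact: hom_lift].
Qed.

Lemma can_endo1 : phi 1 = 1.
Proof. by rewrite /can_endo -[RHS]sum_SS; apply: eq_bigr => i _; rewrite mulr1. Qed.

Lemma can_endo_S z i : phi z * S i = S i * z.
Proof.
rewrite mulr_suml (bigD1 i) //= big1 ?addr0 => [|j ji].
  by rewrite -mulrA adjSS eqxx mulr1.
by rewrite -mulrA adjSS (negPf ji) mulr0.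
Qed.

Lemma can_endo_adj z : phi (adj z) = adj (phi z).
Proof. by rewrite adj_sum; apply: eq_bigr => i _; rewrite !adjM adjK mulrA. Qed.

Lemma can_endoM x y : phi (x * y) = phi x * phi y.
Proof.
rewrite [phi y]/can_endo mulr_sumr; apply: eq_bigr => i _.
by rewrite !mulrA can_endo_S.
Qed.

Lemma can_endo_lin (a : K[i]) x y : phi (a *: x + y) = a *: phi x + phi y.
Proof.
rewrite scaler_sumr -big_split; apply: eq_bigr => i _ /=.
by rewrite mulrDr mulrDl bop_scaleAr bop_scaleAl.
Qed.

Lemma can_endo_prod n (F : 'I_n -> bop H) : phi (\prod_i F i) = \prod_i phi (F i).
Proof. exact: (big_morph _ can_endoM can_endo1). Qed.

Lemma iter_can_endoM n x y : iter n phi (x * y) = iter n phi x * iter n phi y.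
Proof. by elim: n => //= n ->; rewrite can_endoM. Qed.

Lemma iter_can_endo1 n : iter n phi 1 = 1.
Proof. by elim: n => //= n ->; rewrite can_endo1. Qed.

Lemma iter_can_endo_adj n x : iter n phi (adj x) = adj (iter n phi x).
Proof. by elim: n => //= n ->; rewrite can_endo_adj. Qed.

Lemma can_endo_hom m n x : hom m n x -> hom m.+1 n.+1 (phi x).
Proof.
move: x; apply: lspan_map; first exact: can_endo_lin.
move=> _ [mu [nu [<- <- ->]]]; apply: lspan_sum => i _.
by rewrite -monomial_cons; apply: (hom_monomial (i :: mu) (i :: nu)).
Qed.

Lemma can_endo_pol x : pol x -> pol (phi x).
Proof.
move: x; apply: lspan_map; first exact: can_endo_lin.
move=> _ [mu [nu ->]]; apply: lspan_sum => i _.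
by rewrite -monomial_cons; apply: pol_monomial.
Qed.

Lemma iter_can_endo_pol n x : pol x -> pol (iter n phi x).
Proof. by move=> px; elim: n => //= n; apply: can_endo_pol. Qed.

Lemma iter_can_endo_hom k m x : hom m m x -> hom (k + m) (k + m) (iter k phi x).
Proof. by move=> hx; elim: k => //= k IH; apply: can_endo_hom. Qed.

Lemma iter_can_endo_word mu z : iter (size mu) phi z * word mu = word mu * z.
Proof.
elim: mu => [|i mu IH]; first by rewrite word_nil mulr1 mul1r.
by rewrite word_cons /= mulrA can_endo_S -mulrA IH mulrA.
Qed.

(** For [|mu| = m], both [phi^m(z) S_mu = S_mu z] and its adjoint hold, so a
    monomial of level [m] lets [phi^m(z)] pass. *)
Lemma hom_comm m x z : hom m m x -> x * iter m phi z = iter m phi z * x.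
Proof.
elim=> {x} [_ [mu [nu [szm szn ->]]]||a x y _ IHx _ IHy].
- have wn : adj (word nu) * iter m phi z = z * adj (word nu).
    apply: (can_inj (@adjK _ _)); rewrite !adjM adjK -iter_can_endo_adj -szn.
    exact: iter_can_endo_word.
  by rewrite /monomial -mulrA wn !mulrA -szm iter_can_endo_word.
- by rewrite mul0r mulr0.
- by rewrite mulrDl mulrDr bop_scaleAl bop_scaleAr IHx IHy.
Qed.

Lemma hom_Fn n x : hom n n x -> Fn S n x.
Proof.
elim=> {x} [_ [mu [nu [szm szn ->]]]||a x y _ [c ->] _ [e ->]].
- have /eqP tm := szm; have /eqP tn := szn.
  exists (fun m' n' => ((m' == Tuple tm) && (n' == Tuple tn))%:R).
  rewrite (bigD1 (Tuple tm)) //= [X in _ = _ + X]big1 => [|m' m'mu]; last first.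
    by rewrite big1 // => n' _; rewrite (negPf m'mu) scale0r.
  rewrite addr0 (bigD1 (Tuple tn)) //= [X in _ = _ + X]big1 => [|n' n'nu]; last first.
    by rewrite (negPf n'nu) andbF scale0r.
  by rewrite !eqxx scale1r addr0.
- exists (fun _ _ => 0); rewrite big1 // => m' _.
  by rewrite big1 // => n' _; rewrite scale0r.
- exists (fun m' n' => a * c m' n' + e m' n').
  rewrite scaler_sumr -big_split; apply: eq_bigr => m' _ /=.
  rewrite scaler_sumr -big_split; apply: eq_bigr => n' _ /=.
  by rewrite scalerDl scalerA.
Qed.

End CuntzMonomials.

(** * Characters of the circle *)

Section CircleIntegrals.
Variable K : realType.

Definition circle (t : K) : K[i] := cos t +i* sin t.

Lemma conj_circle t : Num.conj (circle t) = circle (- t).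
Proof. by rewrite /circle cosN sinN. Qed.

Lemma circleD s t : circle (s + t) = circle s * circle t.
Proof. by rewrite /circle cosD sinD; simpc; rewrite [X in _ +i* X]addrC. Qed.

Lemma circle0 : circle 0 = 1. Proof. by rewrite /circle cos0 sin0. Qed.

Lemma circleX t n : circle t ^+ n = circle (n%:R * t).
Proof.
elim: n => [|n IH]; first by rewrite expr0 mul0r circle0.
by rewrite exprS IH -circleD -[n.+1]add1n natrD mulrDl mul1r.
Qed.

Lemma circle_monomial t m n :
  circle t ^+ m * Num.conj (circle t) ^+ n = circle ((m%:R - n%:R) * t).
Proof. by rewrite conj_circle !circleX -circleD mulrN mulrBl. Qed.

Lemma circle_2pi : circle (2 * pi) = 1.
Proof. by rewrite /circle mulr2n mulrDl mul1r -mulr2n cos2pi sin2pi. Qed.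

(** The antiderivative returns to its initial value, since the frequency [k]
    completes a whole number of turns. *)
Lemma circle_integral0 (k a b : K) : k != 0 -> circle (k * (2 * pi)) = 1 ->
  \int[lebesgue_measure]_(t in `[0, 2 * pi]) (a * cos (k * t) + b * sin (k * t)) = 0 :> K.
Proof.
move=> k0 [cos1 sin0'].
pose F (t : K) := a / k * sin (k * t) - b / k * cos (k * t).
have dF (t : K) : is_derive t (1 : K) F (a * cos (k * t) + b * sin (k * t)).
  rewrite /F; apply: is_derive_eq.
  rewrite /GRing.scale /=; field; exact: k0.
have pi0 : 0 < 2 * pi :> K by rewrite mulr_gt0 // pi_gt0.
have cF (t : K) : {for t, continuous F}.
  by apply: differentiable_continuous; apply/derivable1_diffP; apply: ex_derive.
rewrite /Rintegral (@continuous_FTC2 _ _ F) //=.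
- by rewrite /F cos1 sin0' !mulr0 cos0 trigo.sin0 !mulr0 subrr.
- apply: continuous_subspaceT => t.
  apply: cvgD; apply: cvgMr.
    apply: (@continuous_comp _ _ _ ( *%R k) cos); first exact: mulrl_continuous.
    exact: continuous_cos.
  apply: (@continuous_comp _ _ _ ( *%R k) sin); first exact: mulrl_continuous.
  exact: continuous_sin.
- split.
  + by move=> t _; apply: ex_derive.
  + by apply: cvg_at_right_filter; apply: cF.
  + by apply: cvg_at_left_filter; apply: cF.
- by move=> t _; rewrite derive1E; apply: derive_val.
Qed.

End CircleIntegrals.

(** * The vector state on monomials *)

Section StarAlgebras.
Variables (K : realType) (H : hilbertType K).
Implicit Types (A B : set (bop H)) (x y : bop H).

Lemma cstar_generated_star A : star_subalgebra (cstar_generated A).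
Proof.
split=> [B [B1 _ _ _] _ _ //|a x y hx hy B sB cB AB|x y hx hy B sB cB AB|x hx B sB cB AB].
- by case: (sB) => _ Bl _ _; apply: Bl; [apply: hx | apply: hy].
- by case: (sB) => _ _ Bm _; apply: Bm; [apply: hx | apply: hy].
- by case: (sB) => _ _ _ Ba; apply: Ba; apply: hx.
Qed.

Lemma sub_cstar_generated A : A `<=` cstar_generated A.
Proof. by move=> x Ax B _ _; apply. Qed.

Lemma commutant_star A : (forall x, A x -> A (adj x)) -> star_subalgebra (commutant A).
Proof.
move=> Aadj; split=> [y _|a x y hx hy z Az|x y hx hy z Az|x hx z Az].
- by rewrite mul1r mulr1.
- by rewrite mulrDl mulrDr bop_scaleAl bop_scaleAr hx // hy.
- by rewrite -mulrA hy // mulrA hx // mulrA.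
- by apply: (can_inj (@adjK _ _)); rewrite !adjM !adjK hx //; apply: Aadj.
Qed.

Lemma bicommutant_star A :
  (forall x, A x -> A (adj x)) -> star_subalgebra (bicommutant A).
Proof.
move=> Aadj; apply: commutant_star.
have [_ _ _ ca] := commutant_star Aadj; exact: ca.
Qed.

Lemma sub_bicommutant A : A `<=` bicommutant A.
Proof. by move=> x Ax y hy; rewrite hy. Qed.

Lemma vN_generated_star A : star_subalgebra (vN_generated A).
Proof.
apply: bicommutant_star => x [Ax|[y Ay <-]]; first by right; exists x.
by left; rewrite adjK.
Qed.

Lemma sub_vN_generated A : A `<=` vN_generated A.
Proof. by move=> x Ax; apply: sub_bicommutant; left. Qed.

Lemma star_subalgebra_prod A n (F : 'I_n -> bop H) :
  star_subalgebra A -> (forall i, A (F i)) -> A (\prod_i F i).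
Proof. by case=> A1 _ AM _ AF; apply: (big_ind A). Qed.

Lemma star_hom_prod A B f n (F : 'I_n -> bop H) :
    star_subalgebra A -> star_hom A B f -> (forall i, A (F i)) ->
  f (\prod_i F i) = \prod_i f (F i).
Proof.
move=> sA [_ _ f1 fM _]; elim: n F => [|n IH] F AF; first by rewrite !big_ord0.
rewrite !big_ord_recl fM ?IH //; exact: star_subalgebra_prod.
Qed.

Lemma star_hom0 A B f : star_subalgebra A -> star_hom A B f -> f 0 = 0.
Proof.
move=> [A1 _ _ _] [_ fl _ _ _].
by have := fl (-1) 1 1 A1 A1; rewrite !scaleN1r !addNr.
Qed.

Lemma star_subalgebra0 A : star_subalgebra A -> A 0.
Proof. by case=> A1 Al _ _; rewrite -(addNr 1) -scaleN1r; apply: Al. Qed.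

End StarAlgebras.

Section GNSState.
Variables (K : realType) (H : hilbertType K) (d : nat) (D : cuntz_gns H d).
Hypothesis hd : (1 < d)%N.
Local Notation S := (cS D).
Local Notation O := (cuntz_algebra S).
Local Notation M := (M_alg D).
Local Notation word := (Defs.word S).
Local Notation om := (omega D).
Local Notation q := (d%:R : K[i]).
Local Notation pol := (pol S).
Local Notation hom := (hom S).
Implicit Types (mu nu : seq 'I_d) (x y z : bop H).

Let HS : cuntz_relations S := cS_rel D.

Lemma d_neq0 : q != 0.
Proof. by rewrite pnatr_eq0 -lt0n (ltn_trans _ hd). Qed.

Lemma cuntz_star : star_subalgebra O. Proof. exact: cstar_generated_star. Qed.
Lemma M_star : star_subalgebra M.
Proof. by apply: bicommutant_star; case: cuntz_star. Qed.
Lemma cuntz_S i : O (S i). Proof. by apply: sub_cstar_generated; exists i. Qed.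

Lemma star_pol A : star_subalgebra A -> (forall i, A (S i)) -> pol `<=` A.
Proof.
move=> sA AS; have [A1 Al AM Aa] := sA.
have Aw mu : A (word mu).
  elim: mu => [|i mu IH]; first by rewrite word_nil.
  by rewrite word_cons; apply: AM.
move=> x; elim=> {x} [_ [mu [nu ->]]||a x y _ Ax _ Ay].
- by apply: AM => //; apply: Aa.
- exact: star_subalgebra0 sA.
- exact: Al.
Qed.

Lemma pol_cuntz : pol `<=` O. Proof. exact: star_pol cuntz_star cuntz_S. Qed.
Lemma pol_M : pol `<=` M.
Proof. by move=> x /pol_cuntz; apply: sub_bicommutant. Qed.

Lemma star_hom_word A B f mu : star_subalgebra A -> (forall i, A (S i)) ->
  star_hom A B f -> f (word mu) = \prod_(i <- mu) f (S i).
Proof.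
move=> sA AS [_ _ f1 fM _]; elim: mu => [|i mu IH]; first by rewrite word_nil big_nil.
rewrite word_cons big_cons fM ?IH //.
by have := star_pol sA AS (pol_monomial S mu [::]); rewrite /monomial word_nil adj1 mulr1.
Qed.

Lemma star_hom_monomial A B f mu nu : star_subalgebra A -> (forall i, A (S i)) ->
  star_hom A B f -> f (monomial S mu nu) = f (word mu) * adj (f (word nu)).
Proof.
move=> sA AS fh; have [_ _ f1 fM fa] := fh; have [_ _ _ Aa] := sA.
have Aw l : A (word l).
  by have := star_pol sA AS (pol_monomial S l [::]); rewrite /monomial word_nil adj1 mulr1.
by rewrite /monomial fM ?fa //; apply: Aa.
Qed.

Lemma gauge_word t mu : gns_gauge D t (word mu) = circle t ^+ size mu *: word mu.
Proof.
have [gh gS] := gns_gaugeP D t.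
rewrite (star_hom_word _ cuntz_star cuntz_S gh).
elim: mu => [|i mu IH]; first by rewrite big_nil word_nil expr0 scale1r.
rewrite big_cons IH word_cons gS bop_scaleAl mul1r bop_scaleAl bop_scaleAr.
by rewrite scalerA exprS.
Qed.

Lemma gauge_monomial t mu nu : gns_gauge D t (monomial S mu nu) =
  circle (((size mu)%:R - (size nu)%:R) * t) *: monomial S mu nu.
Proof.
have [gh gS] := gns_gaugeP D t.
rewrite (star_hom_monomial _ _ cuntz_star cuntz_S gh) !gauge_word.
rewrite adjZ bop_scaleAl bop_scaleAr scalerA rmorphXn /=.
by rewrite circle_monomial.
Qed.

(** The gauge automorphisms multiply [S_mu S_nu^*] by a character of the circle,
    whose mean over a period is [1] or [0] according as it is trivial or not. *)
Lemma E0_monomial mu nu :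
  gns_E0 D (monomial S mu nu) = monomial S mu nu *+ (size mu == size nu).
Proof.
apply: bop_ext_dot => xi eta.
rewrite (gns_E0P (pol_cuntz (pol_monomial S mu nu)) xi eta).
set x := monomial S mu nu; set h := hdot xi (x eta).
have pi0 : 2 * pi != 0 :> K by rewrite mulf_neq0 ?gt_eqF ?pi_gt0.
have gE t : hdot xi (gns_gauge D t x eta)
    = circle (((size mu)%:R - (size nu)%:R) * t) * h.
  by rewrite gauge_monomial bopE_scale hdotZr.
under eq_Rintegral do rewrite gE.
under [X in _ +i* (_ * X)]eq_Rintegral do rewrite gE.
have [smn|smn] := eqVneq (size mu) (size nu).
  rewrite smn subrr mulr1n.
  have cst (c : K) : (2 * pi)^-1 * \int[lebesgue_measure]_(t in `[0, 2 * pi]) c = c.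
    rewrite Rintegral_cst //= lebesgue_measure_itv /=.
    have -> : (0 < (2 * pi)%:E :> \bar K)%E by rewrite lte_fin mulr_gt0 // pi_gt0.
    by rewrite oppr0 adde0 /= mulrC mulfK.
  under eq_Rintegral do rewrite mul0r circle0 mul1r.
  under [X in _ +i* (_ * X)]eq_Rintegral do rewrite mul0r circle0 mul1r.
  by rewrite !cst -/h; case: h {gE}.
rewrite mulr0n bopE_zero hdot0r; set k : K := _ - _.
have k0 : k != 0 by rewrite subr_eq0 eqr_nat.
have k1 : circle (k * (2 * pi)) = 1.
  by rewrite -circle_monomial circle_2pi rmorph1 !expr1n mulr1.
have -> : \int[lebesgue_measure]_(t in `[0, 2 * pi]) complex.Re (circle (k * t) * h) = 0 :> K.
  rewrite -[RHS](circle_integral0 (complex.Re h) (- complex.Im h) k0 k1).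
  by apply: eq_Rintegral => t _; case: (h) => a b /=; ring.
have -> : \int[lebesgue_measure]_(t in `[0, 2 * pi]) complex.Im (circle (k * t) * h) = 0 :> K.
  rewrite -[RHS](circle_integral0 (complex.Im h) (complex.Re h) k0 k1).
  by apply: eq_Rintegral => t _; case: (h) => a b /=; ring.
by rewrite mulr0.
Qed.

Lemma omD x y : om (x + y) = om x + om y.
Proof. by rewrite /omega bopE_add hdotDr. Qed.
Lemma omZ a x : om (a *: x) = a * om x.
Proof. by rewrite /omega bopE_scale hdotZr. Qed.
Lemma om0 : om 0 = 0. Proof. by rewrite /omega bopE_zero hdot0r. Qed.
Lemma omN x : om (- x) = - om x.
Proof. by rewrite /omega bopE_opp hdotNr. Qed.
Lemma omB x y : om (x - y) = om x - om y. Proof. by rewrite omD omN. Qed.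
Lemma omMn x n : om (x *+ n) = om x *+ n.
Proof. by elim: n => [|n IH]; rewrite ?mulr0n ?om0 // !mulrS omD IH. Qed.
Lemma om_sum (I : Type) (r : seq I) (P : pred I) (F : I -> bop H) :
  om (\sum_(i <- r | P i) F i) = \sum_(i <- r | P i) om (F i).
Proof. exact: (big_morph _ omD om0). Qed.
Lemma om_adj x : om (adj x) = Num.conj (om x).
Proof. by rewrite /omega -hdotC hdot_adjr. Qed.
Lemma omE x y : om (adj x * y) = hdot (x (gns_Omega D)) (y (gns_Omega D)).
Proof. by rewrite /omega bopE_mul hdot_adjr. Qed.

Lemma FnFd n : Fn S n `<=` Fd S.
Proof.
move=> x Fx e e0; exists x; first by exists n.
apply: le_lt_trans e0; rewrite subrr.
by apply: opnorm_le => // v; rewrite mul0r bopE_zero hnorm0.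
Qed.

Lemma hom_Fd n x : hom n n x -> Fd S x.
Proof. by move=> hx; apply: FnFd; apply: hom_Fn hx. Qed.

Lemma tau0 : gns_tau D 0 = 0.
Proof.
have [tl t1 _ _] := gns_tauP D; have F1 := hom_Fd (hom_one S).
by have := tl (-1) 1 1 F1 F1; rewrite scaleN1r mulN1r !addNr.
Qed.

Lemma tau_lin n a x y : hom n n x -> hom n n y ->
  gns_tau D (a *: x + y) = a * gns_tau D x + gns_tau D y.
Proof.
by move=> hx hy; have [tl _ _ _] := gns_tauP D; apply: tl; apply: hom_Fd; eassumption.
Qed.

Lemma om_E0 x : O x -> om x = gns_tau D (gns_E0 D x).
Proof. by move=> Ox; rewrite /omega gns_omega. Qed.

Lemma tau_om n x : hom n n x -> gns_tau D x = om x.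
Proof.
elim=> {x} [_ [mu [nu [szm szn ->]]]||a x y hx IHx hy IHy].
- rewrite om_E0; last exact: pol_cuntz (pol_monomial _ _ _).
  by rewrite E0_monomial szm szn eqxx.
- by rewrite tau0 om0.
- by rewrite omD omZ -IHx -IHy (tau_lin _ hx hy).
Qed.

Lemma om_monomial_size mu nu : size mu != size nu -> om (monomial S mu nu) = 0.
Proof.
move=> smn; rewrite om_E0; last exact: pol_cuntz (pol_monomial _ _ _).
by rewrite E0_monomial (negPf smn) mulr0n tau0.
Qed.

Lemma hom_monomial_size n mu nu :
  size mu = n -> size nu = n -> hom n n (monomial S mu nu).
Proof. by move=> sm sn; have := hom_monomial S mu nu; rewrite sm sn. Qed.

Lemma monomialM mu nu mu' nu' : size nu = size mu' ->
  monomial S mu nu * monomial S mu' nu' = monomial S mu nu' *+ (nu == mu').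
Proof.
move=> snm; rewrite /monomial mulrA -(mulrA (word mu)) adj_word_word //.
by rewrite mulr_natr mulrnAl.
Qed.

(** All the minimal projections [S_mu S_mu^*] of a given level are equivalent,
    so a trace takes the same value on each of them, and it vanishes on the
    off-diagonal matrix units. *)
Lemma om_monomial_proj n mu nu rho : size mu = n -> size nu = n -> size rho = n ->
  om (monomial S mu nu) = om (monomial S rho rho) *+ (mu == nu).
Proof.
move=> sm sn sr; have [_ _ _ tM] := gns_tauP D.
have hm k l : size k = n -> size l = n -> Fd S (monomial S k l).
  by move=> sk sl; apply: hom_Fd (hom_monomial_size sk sl).
have om_tau k l : size k = n -> size l = n ->
    om (monomial S k l) = gns_tau D (monomial S k l).
  by move=> sk sl; rewrite -(tau_om (hom_monomial_size sk sl)).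
have -> : monomial S mu nu = monomial S mu rho * monomial S rho nu.
  by rewrite monomialM // eqxx.
rewrite -(tau_om (hom_mul HS (hom_monomial_size sm sr) (hom_monomial_size sr sn))).
rewrite tM; [|exact: hm..]; rewrite monomialM ?sn // eq_sym.
by case: (mu == nu); rewrite ?mulr1n ?mulr0n ?tau0 // om_tau.
Qed.

(** Splitting a projection of level [n] into the [d] equivalent projections of
    level [n + 1] below it divides the trace by [d]. *)
Lemma om_monomial mu nu :
  om (monomial S mu nu) = (mu == nu)%:R * q ^- size mu.
Proof.
have [smn|smn] := eqVneq (size mu) (size nu); last first.
  rewrite om_monomial_size //; case: eqP => [eq_mn|_]; last by rewrite mul0r.
  by rewrite eq_mn eqxx in smn.
rewrite (om_monomial_proj (erefl _) (esym smn) (erefl _)) -[LHS]mulr_natl; congr (_ * _).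
elim/last_ind: mu {nu smn} => [|mu i IH].
  have := tau_om (hom_one S); have [_ -> _ _] := gns_tauP D.
  by rewrite /monomial word_nil adj1 mulr1 => <-; rewrite expr0 invr1.
apply: (mulfI d_neq0); rewrite size_rcons exprS invfM mulrA mulfV ?d_neq0 // mul1r -IH.
have -> : monomial S mu mu = \sum_j monomial S (rcons mu j) (rcons mu j).
  transitivity (word mu * (\sum_j S j * adj (S j)) * adj (word mu)).
    by rewrite (sum_SS HS) mulr1.
  rewrite mulr_sumr mulr_suml; apply: eq_bigr => j _.
  by rewrite /monomial !word_rcons adjM !mulrA.
rewrite om_sum (eq_bigr (fun=> om (monomial S (rcons mu i) (rcons mu i)))).
  by rewrite sumr_const card_ord mulr_natl.
move=> j _; rewrite (@om_monomial_proj (size mu).+1 _ _ (rcons mu i)) ?size_rcons //.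
by rewrite eqxx.
Qed.
Lemma om1 : om 1 = 1.
Proof.
have := om_monomial [::] [::].
by rewrite /monomial word_nil adj1 mulr1 eqxx expr0 invr1 mulr1.
Qed.

End GNSState.

(** * The scaling relation of the vector state *)

Section KMS.
Variables (K : realType) (H : hilbertType K) (d : nat) (D : cuntz_gns H d).
Hypothesis hd : (1 < d)%N.
Local Notation S := (cS D).
Local Notation M := (M_alg D).
Local Notation word := (Defs.word S).
Local Notation om := (omega D).
Local Notation Om := (gns_Omega D).
Local Notation q := (d%:R : K[i]).
Local Notation pol := (pol S).
Local Notation hom := (hom S).
Local Notation phi := (can_endo S).
Implicit Types (mu nu : seq 'I_d) (x y z t : bop H) (r s : K[i]).

Let HS : cuntz_relations S := cS_rel D.

(** Moving [x] around the state costs the factor [r]. Positivity makes [r] real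
    and invertible, so that the relation passes to adjoints. *)
Definition kms r x := [/\ 0 < r, pol x & forall z, pol z -> om (x * z) = r * om (z * x)].

Lemma q_gt0 : 0 < q. Proof. by rewrite ltr0n (ltn_trans _ hd). Qed.

Lemma kms1 : kms 1 1.
Proof. by split=> [||z _]; rewrite ?ltr01 ?mul1r ?mulr1 //; apply: pol1. Qed.

Lemma kmsM r s x y : kms r x -> kms s y -> kms (r * s) (x * y).
Proof.
move=> [r0 px xk] [s0 py yk]; split; [exact: mulr_gt0|exact: pol_mul|move=> z pz].
rewrite -mulrA xk; last exact: pol_mul.
rewrite -mulrA yk; last exact: pol_mul.
by rewrite !mulrA.
Qed.

Lemma kms_adj r x : kms r x -> kms r^-1 (adj x).
Proof.
move=> [r0 px xk]; split; [by rewrite invr_gt0|exact: pol_adj|move=> z pz].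
rewrite -[adj x * z]adjK om_adj adjM adjK.
have := xk _ (pol_adj pz); rewrite -[x * adj z]adjK om_adj adjM adjK => zx.
have rr : Num.conj r = r by apply: conj_Creal; apply: gtr0_real.
apply: (mulfI (lt0r_neq0 r0)); rewrite mulrA mulfV ?lt0r_neq0 // mul1r.
by rewrite -[om (z * adj x)]conjCK zx rmorphM /= rr.
Qed.

(** Explicit on monomials: placed on the left of [S_mu] or on the right of
    [S_nu^*], the letter [i] must match the first letter of [nu], and in the
    first case this pair of letters contributes [1/d]. *)
Lemma kms_S i : kms q^-1 (S i).
Proof.
split; [by rewrite invr_gt0 q_gt0|exact: pol_S|move=> z].
elim=> {z} [_ [mu [nu ->]]||a x y _ IHx _ IHy]; last first.
- by rewrite mulrDl mulrDr bop_scaleAl bop_scaleAr !omD !omZ IHx IHy; ring.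
- by rewrite mul0r mulr0 om0 mulr0.
rewrite {1}/monomial mulrA -word_cons om_monomial //.
case: nu => [|j nu].
  have -> : monomial S mu [::] * S i = monomial S (rcons mu i) [::].
    by rewrite /monomial word_nil adj1 !mulr1 word_rcons.
  by rewrite om_monomial //; case: mu => [|k mu]; rewrite /= !mul0r mulr0.
have -> : monomial S mu (j :: nu) * S i = monomial S mu nu *+ (i == j).
  rewrite /monomial -mulrA -[adj _ * S i]adjK adjM adjK adjS_word //.
  by case: (i == j); rewrite ?mulr1n ?mulr0n ?adj0 ?mulr0.
rewrite omMn om_monomial // eqseq_cons /= exprS invfM.
by case: (i == j); rewrite ?mulr1n ?mulr0n ?mul0r ?mulr0 //= mulrCA.
Qed.

Lemma kms_prod (X : 'I_d -> bop H) : (forall i, kms q^-1 (X i)) ->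
  forall mu, kms (q ^- size mu) (\prod_(i <- mu) X i).
Proof.
move=> Xk; elim=> [|i mu IH]; first by rewrite big_nil expr0 invr1; apply: kms1.
by rewrite big_cons exprS invfM; apply: kmsM.
Qed.

Lemma kms_monomial_gen (X : 'I_d -> bop H) : (forall i, kms q^-1 (X i)) ->
  forall mu nu, kms (q ^- size mu * q ^+ size nu)
    ((\prod_(i <- mu) X i) * adj (\prod_(i <- nu) X i)).
Proof.
move=> Xk mu nu; apply: kmsM; first exact: kms_prod.
by rewrite -[q ^+ _]invrK; apply: kms_adj; apply: kms_prod.
Qed.

Lemma kms_monomial mu nu : kms (q ^- size mu * q ^+ size nu) (monomial S mu nu).
Proof. exact: kms_monomial_gen kms_S mu nu. Qed.

(** In [F_d^n] the scaling factors of the creators and of the annihilators cancel. *)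
Lemma kms_hom n x : hom n n x -> kms 1 x.
Proof.
move=> hx; split; [exact: ltr01 | exact: hom_pol hx |].
elim: hx => {x} [_ [mu [nu [sm sn ->]]]||a x y _ IHx _ IHy] z pz.
- have [_ _ -> //] := kms_monomial mu nu.
  by rewrite sm sn mulVf // expf_neq0 // d_neq0.
- by rewrite mul0r mulr0 om0 mulr0.
- by rewrite mulrDl mulrDr bop_scaleAl bop_scaleAr !omD !omZ IHx // IHy // !mul1r.
Qed.

Lemma om_trace n x z : hom n n x -> pol z -> om (x * z) = om (z * x).
Proof. by move=> /kms_hom [_ _ xk] /xk ->; rewrite mul1r. Qed.

Lemma kms_om0 r x : kms r x -> r != 1 -> om x = 0.
Proof.
move=> [_ _ xk] r1; have := xk _ (pol1 S); rewrite mulr1 mul1r => xr.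
have /eqP : (1 - r) * om x = 0 by rewrite mulrBl mul1r -xr subrr.
by rewrite mulf_eq0 subr_eq0 eq_sym (negPf r1) => /eqP.
Qed.

(** For [d > 1] an element of non-zero gauge degree has a scaling factor
    different from [1], whereas [omega(x 1) = omega(1 x)]. *)
Lemma kms_offdiag mu nu x :
  kms (q ^- size mu * q ^+ size nu) x -> size mu != size nu -> om x = 0.
Proof.
move=> kx smn; apply: (kms_om0 kx).
apply: contraNneq smn => /(congr1 (fun w : K[i] => q ^+ size mu * w)).
rewrite mulrA mulfV ?mul1r ?mulr1 ?expf_neq0 ?d_neq0 // => /eqP.
by rewrite -!natrX eqr_nat eqn_exp2l // eq_sym.
Qed.

(** * Left inverses are determined by polynomials *)

(** The operators preserving the closure of the polynomial vectors, together
    with their adjoints, form a norm-closed star-algebra that contains the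
    [S_i], hence the Cuntz algebra; cyclicity concludes. *)
Lemma dense_pol (xi : H) (e : K) : 0 < e -> exists2 x, pol x & hnorm (x Om - xi) < e.
Proof.
pose V : set H := [set v | forall e : K, 0 < e -> exists2 x, pol x & hnorm (x Om - v) < e].
have Vlin a v w : V v -> V w -> V (a *: v + w).
  move=> Vv Vw e0 e0p; have [c c0 ca] := hnormZ H a.
  have [x px xv] := Vv (e0 / 2 / (c + 1)) ltac:(by rewrite !divr_gt0 // ltr_wpDl).
  have [y py yw] := Vw (e0 / 2) ltac:(by rewrite divr_gt0).
  exists (a *: x + y); first exact: lspan_lin.
  have -> : (a *: x + y) Om - (a *: v + w) = a *: (x Om - v) + (y Om - w).
    by rewrite bopE_add bopE_scale scalerBr opprD addrACA.
  apply: le_lt_trans (Defs.hnormD _ _) _; rewrite ca (splitr e0) ler_ltD //.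
  apply: le_trans (ler_wpM2l c0 (ltW xv)) _.
  rewrite mulrA ler_pdivrMr ?ltr_wpDl // mulrC ler_wpM2l ?lerDl //.
  by rewrite divr_ge0 // ltW.
have Vlim v : (forall e0 : K, 0 < e0 -> exists2 w, V w & hnorm (w - v) < e0) -> V v.
  move=> hv e0 e0p; have e2 : 0 < e0 / 2 by rewrite divr_gt0.
  have [w Vw wv] := hv _ e2; have [x px xw] := Vw _ e2; exists x => //.
  have -> : x Om - v = (x Om - w) + (w - v) by rewrite addrA subrK.
  by apply: le_lt_trans (Defs.hnormD _ _) _; rewrite (splitr e0) ltrD.
have VS x v : pol x -> V v -> V (x v).
  move=> px Vv e0 e0p; have x1 : 0 < opnorm x + 1 by rewrite ltr_wpDl ?opnorm_ge0.
  have [y py yv] := Vv (e0 / (opnorm x + 1)) ltac:(by rewrite divr_gt0).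
  exists (x * y); first exact: pol_mul.
  have -> : (x * y) Om - x v = x (y Om - v).
    by rewrite bopE_mul -[- v]scaleN1r bopD bopZ scaleN1r.
  apply: le_lt_trans (opnorm_bound _ _) _.
  apply: le_lt_trans (_ : (opnorm x + 1) * hnorm (y Om - v) < e0).
    by rewrite ler_wpM2r ?hnorm_ge0 // lerDl.
  by rewrite mulrC -ltr_pdivlMr.
pose B : set (bop H) := [set x : bop H | forall v, V v -> V (x v) /\ V (adj x v)].
have VOm : V Om.
  by move=> e0 e0p; exists 1; [apply: pol1 | rewrite bopE_one subrr hnorm0].
have V0 : V 0 by have := Vlin (-1) _ _ VOm VOm; rewrite scaleN1r addNr.
have sB : star_subalgebra B.
  split=> [v Vv|a x y Bx By v Vv|x y Bx By v Vv|x Bx v Vv].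
  - by rewrite adj1 bopE_one.
  - rewrite adjD adjZ !bopE_add !bopE_scale.
    by split; apply: Vlin; [case: (Bx v Vv)|case: (By v Vv)|case: (Bx v Vv)|case: (By v Vv)].
  - rewrite adjM !bopE_mul; split.
      by have [] := Bx (y v) (proj1 (By v Vv)).
    by have [] := By (adj x v) (proj2 (Bx v Vv)).
  - by rewrite adjK; have [] := Bx v Vv.
have cB : norm_closure B `<=` B.
  move=> x Bx v Vv.
  have x1 : 0 < hnorm v + 1 by rewrite ltr_wpDl ?hnorm_ge0.
  have key e0 : 0 < e0 -> exists2 y, B y & opnorm (x - y) * hnorm v < e0.
    move=> e0p; have [y By xy] := Bx (e0 / (hnorm v + 1)) ltac:(by rewrite divr_gt0).
    exists y => //; apply: le_lt_trans (_ : opnorm (x - y) * (hnorm v + 1) < e0).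
      by rewrite ler_wpM2l ?opnorm_ge0 // lerDl.
    by rewrite -ltr_pdivlMr.
  split; apply: Vlim => e0 e0p; have [y By xy] := key _ e0p.
    exists (y v); first by case: (By v Vv).
    rewrite hnormBC -bopE_opp -bopE_add.
    exact: le_lt_trans (opnorm_bound _ _) xy.
  exists (adj y v); first by case: (By v Vv).
  rewrite hnormBC -bopE_opp -bopE_add -adjB.
  exact: le_lt_trans (hnorm_adj_bound _ _) xy.
have BS : range S `<=` B.
  move=> _ [i _ <-] v Vv; split; apply: VS => //; first exact: pol_S.
  by apply: pol_adj; apply: pol_S.
move=> e0p; have e2 : 0 < e / 2 by rewrite divr_gt0.
have [x Ox xxi] := gns_cyclic D xi e2.
have [y py yx] := proj1 (Ox B sB cB BS Om VOm) _ e2.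
exists y => //; have -> : y Om - xi = (y Om - x Om) + (x Om - xi) by rewrite addrA subrK.
by apply: le_lt_trans (Defs.hnormD _ _) _; rewrite (splitr e) ltrD.
Qed.

Lemma pol_ortho (w : H) : (forall a, pol a -> hdot (a Om) w = 0) -> w = 0.
Proof.
move=> aw; apply: hnorm_eq0; apply/eqP; apply: contraT => w0.
have wp : 0 < hnorm w by rewrite lt_def w0 hnorm_ge0.
have [a pa aw'] := dense_pol w wp.
have : hnorm w ^+ 2 <= hnorm (w - a Om) * hnorm w.
  apply: le_trans (cauchy_schwarz _ _).
  by rewrite hdotDl hdotNl aw // oppr0 addr0 hdot_hnorm.
by rewrite expr2 ler_pM2r // hnormBC leNgt aw'.
Qed.

Lemma pol_sandwich x y :
  (forall a b, pol a -> pol b -> om (a * x * b) = om (a * y * b)) -> x = y.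
Proof.
move=> xy; apply/eqP; rewrite -subr_eq0; apply/eqP; set t := x - y.
have tab a b : pol a -> pol b -> hdot (a Om) (t (b Om)) = 0.
  move=> pa pb; have /eqP := xy (adj a) b (pol_adj pa) pb.
  rewrite -subr_eq0 -omB -mulrBl -mulrBr -/t => /eqP.
  by rewrite /omega !bopE_mul hdot_adj adjK.
have tb b : pol b -> t (b Om) = 0 by move=> pb; apply: pol_ortho => a pa; apply: tab.
have ta v : adj t v = 0.
  apply: pol_ortho => a pa; rewrite hdotC -hdot_adj tb // hdot0r.
  exact: conjC0.
by rewrite -[t]adjK; rewrite (_ : adj t = 0) ?adj0 //; apply: bopP.
Qed.

(** The vector state is faithful on polynomials: if [x Om = 0], the scaling
    relation moves any polynomial [b] past the state, so [<a Om, x b Om> = 0]. *)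
Lemma om_faithful x : pol x -> om (adj x * x) = 0 -> x = 0.
Proof.
move=> px; rewrite omE => /hdot_eq0 xOm; apply: pol_sandwich => a b pa.
rewrite mulr0 mul0r om0; elim=> {b} [_ [mu [nu ->]]||c y z _ IHy _ IHz].
- have [r0 _ /(_ _ (pol_mul HS pa px))/esym/eqP] := kms_monomial mu nu.
  rewrite {2}/omega !bopE_mul xOm !bop0 hdot0r mulf_eq0 => /orP[/eqP r00|/eqP //].
  by rewrite r00 ltxx in r0.
- by rewrite mulr0 om0.
- by rewrite mulrDr bop_scaleAr omD omZ IHy IHz mulr0 addr0.
Qed.

(** Two vectors of the same norm whose inner product is the square of that norm
    coincide; faithfulness turns vectors into operators. *)
Lemma om_eq2 y t : pol y -> pol t -> om (adj y * y) = om (adj t * t) ->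
  om (adj t * y) = om (adj t * t) -> y = t.
Proof.
move=> py pt yy ty; apply/eqP; rewrite -subr_eq0; apply/eqP.
apply: om_faithful; first exact: lspanB.
have yt : om (adj y * t) = om (adj t * t).
  by rewrite -[adj y * t]adjK om_adj adjM adjK ty -om_adj adjM adjK.
rewrite adjB mulrBl !mulrBr !omB yy ty yt; ring.
Qed.

Section LeftInverse.
Variables (u : bop H) (lam : bop H -> bop H).
Hypotheses (uk : kms 1 u) (lamP : is_lambda D u lam).

Lemma lam_hom : star_hom M M lam. Proof. by case: lamP => [[]]. Qed.
Lemma lam_S i : lam (S i) = u * S i. Proof. by case: lamP => [[]]. Qed.

Lemma M_S i : M (S i). Proof. by apply: pol_M; apply: pol_S. Qed.

Lemma lam_lin a x y : pol x -> pol y -> lam (a *: x + y) = a *: lam x + lam y.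
Proof. by move=> px py; have [_ ll _ _ _] := lam_hom; apply: ll; apply: pol_M. Qed.

Lemma lamM x y : pol x -> pol y -> lam (x * y) = lam x * lam y.
Proof. by move=> px py; have [_ _ _ ll _] := lam_hom; apply: ll; apply: pol_M. Qed.

Lemma lam0 : lam 0 = 0. Proof. exact: star_hom0 (M_star D) lam_hom. Qed.

Lemma lam_word mu : lam (word mu) = \prod_(i <- mu) (u * S i).
Proof.
rewrite (star_hom_word _ (M_star D) M_S lam_hom).
by apply: eq_bigr => i _; rewrite lam_S.
Qed.

Lemma lam_monomial mu nu : lam (monomial S mu nu) =
  (\prod_(i <- mu) (u * S i)) * adj (\prod_(i <- nu) (u * S i)).
Proof. by rewrite (star_hom_monomial _ _ (M_star D) M_S lam_hom) !lam_word. Qed.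

(** Since [u] moves freely around the state, [u S_i] scales like [S_i]. *)
Lemma kms_lam mu nu : kms (q ^- size mu * q ^+ size nu) (lam (monomial S mu nu)).
Proof.
rewrite lam_monomial; apply: kms_monomial_gen => i.
by rewrite -[q^-1]mul1r; apply: kmsM => //; apply: kms_S.
Qed.

Lemma lam_pol x : pol x -> pol (lam x).
Proof.
elim=> {x} [_ [mu [nu ->]]||a x y px IHx py IHy].
- by case: (kms_lam mu nu).
- by rewrite lam0; apply: lspan0.
- by rewrite lam_lin //; apply: lspan_lin.
Qed.

End LeftInverse.

(** The left inverse is the adjoint of [lambda_u] for the form
    [omega(x y)], so its values are determined by pairing with polynomials. *)
Lemma left_inverse_eq u ph y t : kms 1 u -> omega_left_inverse D u ph ->
  pol y -> pol t ->
  (forall lam, is_lambda D u lam -> forall mu nu,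
     om (y * lam (monomial S mu nu)) = om (t * monomial S mu nu)) ->
  ph y = t.
Proof.
move=> uk [lam lamP [[phM _ _ _ _] phl phom [_ _ _ phE _] _]] py pt yt.
have {}yt c : pol c -> om (y * lam c) = om (t * c).
  elim=> {c} [_ [mu [nu ->]]||a c e pc IHc pe IHe].
  - exact: yt.
  - by rewrite (lam0 lamP) !mulr0.
  - by rewrite (lam_lin lamP) // !mulrDr !bop_scaleAr !omD !omZ IHc IHe.
have [_ _ MM _] := M_star D.
have phb a b : pol a -> pol b -> a * ph y * b = ph (lam a * y * lam b).
  move=> pa pb.
  have [Ma Mb My] : [/\ M a, M b & M y] by split; apply: pol_M.
  have Ml x : M x -> M (lam x) by have [hm _ _ _ _] := lam_hom lamP; apply: hm.
  have E := phE (lam a) y (lam b) (ex_intro2 _ _ a Ma erefl) My (ex_intro2 _ _ b Mb erefl).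
  have := congr1 ph E; rewrite /= phl; last first.
    by apply: phM; apply: (MM); [apply: (MM); [apply: (Ml)|]|apply: (Ml)].
  move=> ->; have [_ _ _ lM _] := lam_hom lamP.
  have My' : M (ph y) by apply: phM.
  by rewrite -lM // -lM ?phl //; do ?[apply: (MM)].
apply: pol_sandwich => a b pa pb; rewrite phb // phom; last first.
  have Ml x : M x -> M (lam x) by have [hm _ _ _ _] := lam_hom lamP; apply: hm.
  by apply: (MM); [apply: (MM); [apply: (Ml)|]|apply: (Ml)]; apply: pol_M.
elim: pa => {a} [_ [mu [nu ->]]||c x z px IHx pz IHz].
- have [_ _ lk] := kms_lam uk lamP mu nu; have [_ _ mk] := kms_monomial mu nu.
  rewrite -mulrA lk; last by apply: pol_mul => //; apply: lam_pol lamP _ pb.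
  rewrite -[_ * t * b]mulrA mk; last exact: pol_mul.
  have pm := pol_monomial S mu nu.
  by rewrite -mulrA -(lamM lamP) // yt -?mulrA //; apply: pol_mul.
- by rewrite (lam0 lamP) !mul0r.
- by rewrite (lam_lin lamP) // !mulrDl !bop_scaleAl !omD !omZ IHx IHz.
Qed.

End KMS.

(** * Partial traces of Yang-Baxter unitaries *)

Ltac in_pol := repeat match goal with
  | |- pol _ (_ * _) => apply: pol_mul
  | |- pol _ (adj _) => apply: pol_adj
  | |- pol _ (can_endo _ _) => apply: can_endo_pol
  | |- pol _ _ => assumption
  | |- cuntz_relations _ => exact: cS_rel
  end.

Section YangBaxter.
Variables (K : realType) (H : hilbertType K) (d : nat) (D : cuntz_gns H d).
Hypothesis hd : (1 < d)%N.
Local Notation S := (cS D).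
Local Notation M := (M_alg D).
Local Notation word := (Defs.word S).
Local Notation om := (omega D).
Local Notation Om := (gns_Omega D).
Local Notation q := (d%:R : K[i]).
Local Notation pol := (pol S).
Local Notation hom := (hom S).
Local Notation phi := (can_endo S).
Implicit Types (mu nu : seq 'I_d) (x y z t R T L : bop H).

Let HS : cuntz_relations S := cS_rel D.

Lemma om_adjl x y : om (adj y * x) = Num.conj (om (adj x * y)).
Proof. by rewrite -om_adj adjM adjK. Qed.

Lemma om_SxS i j x : pol x -> om (S i * x * adj (S j)) = q^-1 * om x *+ (i == j).
Proof.
move=> px; have [_ _ k] := kms_S D hd i.
rewrite -mulrA k; last by apply: pol_mul => //; apply: pol_adj; apply: pol_S.
rewrite -mulrA adjSS // eq_sym; case: (i == j); first by rewrite mulr1.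
by rewrite mulr0 om0 mulr0.
Qed.

Lemma om_can_endo x : pol x -> om (phi x) = om x.
Proof.
move=> px; rewrite om_sum (eq_bigr (fun=> q^-1 * om x)) => [|i _]; last first.
  by rewrite om_SxS // eqxx.
by rewrite sumr_const card_ord -[LHS]mulr_natl mulrA mulfV ?mul1r ?d_neq0.
Qed.

(** The pairings of [phi y] with level [m + 1] are pairings of [y] with level
    [m], because [phi y * S_i = S_i * y]. *)
Lemma om_shift_test m y t : pol y -> pol t ->
    (forall x, hom m m x -> om (y * x) = om (t * x)) ->
  forall x, hom m.+1 m.+1 x -> om (phi y * x) = om (phi t * x).
Proof.
move=> py pt yt x; elim=> {x} [_ [mu [nu [sm sn ->]]]||a x z _ IHx _ IHz]; last first.
- by rewrite !mulrDr !bop_scaleAr !omD !omZ IHx IHz.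
- by rewrite !mulr0.
case: mu sm => // i mu [sm]; case: nu sn => // j nu [sn].
have shiftE z : phi z * monomial S (i :: mu) (j :: nu) =
    S i * (z * monomial S mu nu) * adj (S j).
  by rewrite monomial_cons !mulrA can_endo_S.
rewrite !shiftE; have pm := pol_monomial S mu nu.
rewrite !om_SxS ?yt //; try exact: pol_mul.
by have := hom_monomial S mu nu; rewrite sm sn.
Qed.

Definition yb_product R n : bop H := \prod_(k < n) iter k phi R.

(** The normalised right and left partial traces [T] and [L] of a unitary
    solution [R] of the braid relation enter only through the pairings that
    characterise them. *)
Record yb_traces R T L : Prop := YbTraces {
  yb_hom : hom 2 2 R;
  yb_unitary : unitary_op R;
  yb_braid : R * phi R * R = phi R * R * phi R;
  yb_homT : hom 1 1 T;
  yb_homL : hom 1 1 L;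
  yb_right : forall x, hom 1 1 x -> om (R * x) = om (T * x);
  yb_left : forall x, pol x -> om (R * phi x) = om (L * x)
}.

Lemma yb_traces_adj R T L : yb_traces R T L -> yb_traces (adj R) (adj T) (adj L).
Proof.
case=> hR [RR1 RR2] br hT hL rt lt; split.
- exact: hom_adj.
- by split; rewrite adjK.
- by have := congr1 (@adj _ _) br; rewrite can_endo_adj !adjM !mulrA.
- exact: hom_adj.
- exact: hom_adj.
- move=> x hx; rewrite om_adjl [RHS]om_adjl; congr Num.conj.
  have hx' := hom_adj hx; have px' := hom_pol hx'.
  by rewrite -(om_trace hd hR) // -(om_trace hd hT) // rt.
- move=> x px; rewrite om_adjl [RHS]om_adjl; congr Num.conj.
  have px' := pol_adj px; rewrite -can_endo_adj.
  rewrite -(om_trace hd hR); last exact: can_endo_pol.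
  by rewrite -(om_trace hd hL) // lt.
Qed.

Section Relations.
Variables R T L : bop H.
Hypothesis RTL : yb_traces R T L.

Let hR : hom 2 2 R := yb_hom RTL.
Let RR1 : adj R * R = 1 := (yb_unitary RTL).1.
Let RR2 : R * adj R = 1 := (yb_unitary RTL).2.
Let br := yb_braid RTL.
Let hT : hom 1 1 T := yb_homT RTL.
Let hL : hom 1 1 L := yb_homL RTL.
Let pR : pol R := hom_pol hR.
Let pT : pol T := hom_pol hT.
Let pL : pol L := hom_pol hL.
Let paR : pol (adj R) := pol_adj pR.

Let pRR1 : adj (phi R) * phi R = 1.
Proof. by rewrite -can_endo_adj -can_endoM // RR1 can_endo1. Qed.
Let pRR2 : phi R * adj (phi R) = 1.
Proof. by rewrite -can_endo_adj -can_endoM // RR2 can_endo1. Qed.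

Lemma unitary_canl (u x : bop H) : adj u * u = 1 -> adj u * (u * x) = x.
Proof. by move=> u1; rewrite mulrA u1 mul1r. Qed.
Lemma braid_conj : adj (phi R) * R * phi R = R * phi R * adj R.
Proof.
rewrite -[LHS]mulr1 -RR2 mulrA -!(mulrA (adj (phi R))) br -!mulrA.
by rewrite unitary_canl.
Qed.

Lemma braid_conj_inv : phi R * R * adj (phi R) = adj R * phi R * R.
Proof.
rewrite -[LHS]mul1r -RR1 -!mulrA; congr (_ * _).
by rewrite !mulrA br -mulrA pRR2 mulr1.
Qed.


(** The two sides have the same 2-norm, so it suffices to compare their inner
    products with [T]. There the right partial trace property replaces
    [phi T] by [phi R], the braid relation moves the conjugation to
    [phi R], and [phi R] commutes with [F_d^1]. *)
Lemma right_trace_move : R * phi T * adj R = T.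
Proof.
have hT' := hom_adj hT; have pT' : pol (adj T) by in_pol.
apply: (@om_eq2 _ _ _ D hd); try by in_pol.
  rewrite !adjM adjK -!mulrA unitary_canl // -can_endo_adj.
  rewrite (om_trace hd hR); last by in_pol.
  by rewrite -!mulrA RR1 mulr1 -can_endoM // om_can_endo //; in_pol.
have hX := hom_mul HS (hom_mul HS (hom_adj hR) (hom_lift HS hT')) hR.
rewrite (om_trace hd hT'); last by in_pol.
rewrite -!mulrA (om_trace hd hR); last by in_pol.
have -> : phi T * (adj R * adj T) * R = phi T * (adj R * adj T * R).
  by rewrite !mulrA.
rewrite -(om_shift_test pR pT (yb_right RTL) hX).
have hR' := can_endo_hom (hom_adj hR).
rewrite (_ : phi R * _ = (phi R * adj R * adj T) * R); last by rewrite !mulrA.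
rewrite -(om_trace hd hR); last by in_pol.
rewrite (_ : R * _ = adj (phi R) * (R * phi R * adj T)); last first.
  by rewrite !mulrA -braid_conj.
rewrite -can_endo_adj (om_trace hd hR'); last by in_pol.
rewrite (_ : R * _ * _ * _ = R * adj T); last first.
  rewrite -!mulrA [adj T * _](hom_comm HS _ hT') /=.
  by rewrite [phi R * _]mulrA -can_endoM // RR2 can_endo1 // mul1r.
by rewrite (yb_right RTL hT') (om_trace hd hT').
Qed.

(** The mirror image of [right_trace_move]. *)
Lemma left_trace_move : R * L * adj R = phi L.
Proof.
have hL' := hom_adj hL; have pL' : pol (adj L) by in_pol.
apply: (@om_eq2 _ _ _ D hd); try by in_pol.
  rewrite !adjM adjK -!mulrA unitary_canl //.
  rewrite (om_trace hd hR); last by in_pol.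
  by rewrite -!mulrA RR1 mulr1 -can_endo_adj -can_endoM // om_can_endo //; in_pol.
rewrite -can_endo_adj -can_endoM // om_can_endo //; last by in_pol.
rewrite (_ : phi (adj L) * _ = phi (adj L) * R * L * adj R); last by rewrite !mulrA.
rewrite -(om_trace hd (hom_adj hR)); last by in_pol.
rewrite (_ : adj R * _ = adj R * phi (adj L) * R * L); last by rewrite !mulrA.
rewrite -(om_trace hd hL); last by in_pol.
rewrite -(yb_left RTL); last by in_pol.
rewrite !can_endoM // (_ : R * _ = R * phi (adj R) * phi (phi (adj L)) * phi R);
  last by rewrite !mulrA.
rewrite -(om_trace hd (can_endo_hom hR)); last by in_pol.
rewrite (_ : phi R * _ = adj R * (phi R * R * phi (phi (adj L)))); last first.
  by rewrite !mulrA -braid_conj_inv can_endo_adj.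
rewrite (om_trace hd (hom_adj hR)); last by in_pol.
rewrite (_ : _ * adj R = phi (R * phi (adj L))); last first.
  rewrite -!mulrA (mulrA R) (hom_comm HS (adj L) hR) /= -mulrA RR2 mulr1.
  by rewrite -can_endoM.
rewrite om_can_endo //; last by in_pol.
by rewrite (yb_left RTL) // (om_trace hd hL).
Qed.

End Relations.

(** [right_trace_move] for [R^*]. *)
Lemma right_trace_move_inv R T L : yb_traces R T L -> R * T * adj R = phi T.
Proof.
move=> RTL; have [RR1 RR2] := yb_unitary RTL.
have := right_trace_move (yb_traces_adj RTL).
rewrite adjK can_endo_adj => /(congr1 (@adj _ _)); rewrite !adjM !adjK => E.
rewrite -[in LHS]E.
by rewrite !mulrA RR2 mul1r -mulrA RR2 mulr1.
Qed.

(** [left_trace_move] for [R^*]. *)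
Lemma left_trace_move_inv R T L : yb_traces R T L -> R * phi L * adj R = L.
Proof.
move=> RTL; have [RR1 RR2] := yb_unitary RTL.
have := left_trace_move (yb_traces_adj RTL).
rewrite adjK can_endo_adj => /(congr1 (@adj _ _)); rewrite !adjM !adjK => E.
rewrite -[in LHS]E.
by rewrite !mulrA RR2 mul1r -mulrA RR2 mulr1.
Qed.

(** Both [<T, L>] and [<L, T>] can be computed: since [phi T = R T R^*], the
    pairing of [T^*] with the left trace of [R] equals the one with the right
    trace, so that [<T, L> = |T|^2]; symmetrically [<L, T> = |L|^2]. *)
Lemma partial_traces_eq R T L : yb_traces R T L -> L = T.
Proof.
move=> RTL; have [RR1 RR2] := yb_unitary RTL.
have hR := yb_hom RTL; have hT := yb_homT RTL; have hL := yb_homL RTL.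
have pR : pol R := hom_pol hR; have pT : pol T := hom_pol hT.
have pL : pol L := hom_pol hL.
have TL : om (adj T * L) = om (adj T * T).
  have hT' := hom_adj hT; have pT' := hom_pol hT'.
  rewrite (om_trace hd hT') // -(yb_left RTL) // can_endo_adj.
  have /(congr1 (@adj _ _)) := right_trace_move_inv RTL; rewrite !adjM adjK => <-.
  rewrite (om_trace hd hR); last by in_pol.
  by rewrite -!mulrA RR1 mulr1 (yb_right RTL) // (om_trace hd hT').
have LT : om (adj L * T) = om (adj L * L).
  have hL' := hom_adj hL; have pL' := hom_pol hL'.
  rewrite (om_trace hd hL') // -(yb_right RTL) // -(om_trace hd hL') //.
  have /(congr1 (@adj _ _)) := left_trace_move_inv RTL; rewrite !adjM adjK => E.
  rewrite -[in LHS]E -!mulrA RR1 mulr1 -can_endo_adj (yb_left RTL) //.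
  by rewrite (om_trace hd hL').
apply/eqP; rewrite -subr_eq0; apply/eqP.
apply: (@om_faithful _ _ _ D hd); first exact: lspanB.
by rewrite adjB mulrBl !mulrBr !omB TL LT; ring.
Qed.


(** Normality: both [T T^*] and [T^* T] are the left partial trace of
    [R T^* = phi T^* R]. *)
Lemma partial_trace_normal R T L : yb_traces R T L -> normal_op T.
Proof.
move=> RTL; have [RR1 RR2] := yb_unitary RTL; have LT := partial_traces_eq RTL.
have hR := yb_hom RTL; have hT := yb_homT RTL; subst L.
have pR : pol R := hom_pol hR; have pT : pol T := hom_pol hT.
have E1 : R * adj T = phi (adj T) * R.
  have /(congr1 (@adj _ _)) := right_trace_move_inv RTL; rewrite can_endo_adj => <-.
  by rewrite !adjM adjK -!mulrA RR1 mulr1.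
have E2 : adj T * R = R * phi (adj T).
  have := congr1 (@adj _ _) (right_trace_move RTL); rewrite !adjM adjK => E.
  by rewrite -[in LHS]E -!mulrA RR1 mulr1 can_endo_adj.
have hT' := hom_adj hT; have pT' : pol (adj T) by in_pol.
have test x : hom 1 1 x -> om (adj T * T * x) = om (T * adj T * x).
  move=> hx; have px : pol x := hom_pol hx.
  have -> : om (adj T * T * x) = om (phi (adj T) * R * phi x).
    rewrite -mulrA (om_trace hd hT'); last by in_pol.
    rewrite -mulrA -(yb_left RTL); last by in_pol.
    rewrite can_endoM // mulrA -(om_trace hd (can_endo_hom hT')); last by in_pol.
    by rewrite mulrA.
  rewrite -E1 -mulrA [adj T * _](hom_comm HS _ hT') /= mulrA.
  rewrite -(om_trace hd hT'); last by in_pol.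
  rewrite mulrA E2 -!mulrA -can_endoM // (yb_left RTL) ?mulrA //.
  by in_pol.
apply/eqP; rewrite -subr_eq0; apply/eqP.
have pN : pol (adj T * T - T * adj T) by apply: polB; in_pol.
apply: (@om_faithful _ _ _ D hd) => //.
have hx : hom 1 1 (adj (adj T * T - T * adj T)).
  by apply/hom_adj/homB; [exact: hom_mul hT' hT|exact: hom_mul hT hT'].
rewrite (om_trace hd hx) //.
by rewrite mulrBl omB test // subrr.
Qed.

Lemma yb_productS R n : yb_product R n.+1 = R * phi (yb_product R n).
Proof. by rewrite /yb_product big_ord_recl can_endo_prod. Qed.

Lemma yb_productSr R n : yb_product R n.+1 = yb_product R n * iter n phi R.
Proof. by rewrite /yb_product big_ord_recr. Qed.

Lemma yb_product0 R : yb_product R 0 = 1.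
Proof. by rewrite /yb_product big_ord0. Qed.

Lemma lam_yb_product R lam mu : is_lambda D R lam ->
  lam (word mu) = yb_product R (size mu) * word mu.
Proof.
move=> lamP; rewrite (lam_word lamP); elim: mu => [|i mu IH].
  by rewrite big_nil word_nil yb_product0 mulr1.
rewrite big_cons IH /= yb_productS word_cons -!mulrA; congr (_ * _).
by rewrite !mulrA can_endo_S.
Qed.

Section Products.
Variables R T L : bop H.
Hypothesis RTL : yb_traces R T L.

Let hR : hom 2 2 R := yb_hom RTL.
Let RR1 : adj R * R = 1 := (yb_unitary RTL).1.
Let RR2 : R * adj R = 1 := (yb_unitary RTL).2.
Let hT : hom 1 1 T := yb_homT RTL.
Let pR : pol R := hom_pol hR.
Let pT : pol T := hom_pol hT.

Local Notation Rn := (yb_product R).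

Lemma yb_product_hom n : hom n.+1 n.+1 (Rn n).
Proof.
elim: n => [|n IH]; first by rewrite yb_product0; apply: hom_lift => //; apply: hom_one.
rewrite yb_productSr; apply: (hom_mul HS (hom_lift HS IH)).
by have := iter_can_endo_hom n hR; rewrite addn2.
Qed.

Lemma yb_product_unitary n : adj (Rn n) * Rn n = 1 /\ Rn n * adj (Rn n) = 1.
Proof.
elim: n => [|n [IH1 IH2]]; first by rewrite yb_product0 adj1 mulr1.
rewrite yb_productS adjM -can_endo_adj; split.
  by rewrite -mulrA (mulrA (adj R)) RR1 mul1r -can_endoM // IH1 can_endo1.
by rewrite mulrA -(mulrA R) -can_endoM // IH2 can_endo1 // mulr1 RR2.
Qed.

Lemma yb_product_shift n k : (k + 2 <= n)%N ->
  Rn n * iter k phi R = iter k.+1 phi R * Rn n.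
Proof.
elim: n k => [|n IH] k kn; first by rewrite addn2 in kn.
case: k kn => [|k] kn.
  case: n {IH} kn => // n _; rewrite !yb_productS can_endoM // -!mulrA.
  have <- := hom_comm HS (Rn n) hR; rewrite /= !mulrA.
  by rewrite (yb_braid RTL).
rewrite yb_productS -mulrA [iter k.+1 phi R]iterS -can_endoM // IH; last by rewrite -ltnS.
rewrite can_endoM // !mulrA; congr (_ * _).
exact: (hom_comm HS (iter k phi R) hR).
Qed.

(** [R_(n+1)] shifts every factor [phi^k(R)] of [R_n], because each lies within
    the first [n + 1] tensor factors. *)
Lemma yb_product_flip n : Rn n.+1 * Rn n = phi (Rn n) * Rn n.+1.
Proof.
suff shift m : (m <= n)%N -> Rn n.+1 * Rn m = phi (Rn m) * Rn n.+1 by exact: shift.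
elim: m => [|m IH] mn; first by rewrite yb_product0 can_endo1 // mul1r mulr1.
rewrite (yb_productSr R m) mulrA IH; last exact: ltnW.
by rewrite -mulrA yb_product_shift ?addn2 ?ltnS // can_endoM // mulrA.
Qed.

(** [R_(n+1)] conjugates [R] into [phi^n(R)] conjugated by [R_n], which moves
    the last leg of [R] beyond the first [n + 1] tensor factors. *)
Lemma yb_product_conj n :
  adj (Rn n.+1) * R * Rn n.+1 = Rn n * iter n phi R * adj (Rn n).
Proof.
have [U1 U2] := yb_product_unitary n; have [V1 V2] := yb_product_unitary n.+1.
have E : R * Rn n.+1 * Rn n = Rn n.+1 * Rn n.+1.
  by rewrite -mulrA yb_product_flip mulrA -yb_productS.
rewrite -yb_productSr -[LHS]mulr1 -U2 !mulrA; congr (_ * _).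
by rewrite -!mulrA (mulrA R) E mulrA V1 mul1r.
Qed.

Lemma yb_product_move n : Rn n * iter n phi T = T * Rn n.
Proof.
elim: n => [|n IH]; first by rewrite yb_product0 mul1r mulr1.
rewrite yb_productS /= -mulrA -can_endoM // IH can_endoM // !mulrA; congr (_ * _).
have := right_trace_move RTL => /(congr1 (fun x => x * R)) => <-.
by rewrite -mulrA RR1 mulr1.
Qed.

Lemma om_iter_right n x : hom n.+1 n.+1 x ->
  om (iter n phi R * x) = om (iter n phi T * x).
Proof.
elim: n x => [|n IH] x hx; first exact: (yb_right RTL).
by apply: om_shift_test IH _ hx; apply: iter_can_endo_pol.
Qed.

(** Over words of equal length, [lambda_R(c) = R_n c R_n^*], and the previous
    identities transport [R] to [phi^n(R)], whose last leg can be traced out. *)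
Lemma om_R_lam lam mu nu : is_lambda D R lam ->
  om (R * lam (monomial S mu nu)) = om (T * monomial S mu nu).
Proof.
move=> lamP; have kR : kms D 1 R by apply: kms_hom hR.
have [smn|smn] := eqVneq (size mu) (size nu); last first.
  have k1 := kmsM kR (kms_lam hd kR lamP mu nu).
  have k2 := kmsM (kms_hom hd hT) (kms_monomial D hd mu nu).
  by rewrite !mul1r in k1 k2; rewrite !(@kms_offdiag _ _ _ D hd mu nu).
rewrite (star_hom_monomial _ _ (M_star D) (@M_S _ _ _ D) (lam_hom lamP)).
rewrite !(lam_yb_product _ lamP) smn adjM -!mulrA.
have hm := hom_monomial S mu nu; rewrite smn in hm.
rewrite [word mu * _]mulrA -/(monomial S mu nu); move: (monomial S mu nu) hm => c.
case: (size nu) => [|n] hc.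
  rewrite yb_product0 adj1 mulr1 mul1r; exact/(yb_right RTL)/hom_lift.
have pc : pol c := hom_pol hc.
have hn := yb_product_hom n; have hn1 := yb_product_hom n.+1.
have pn : pol (Rn n) := hom_pol hn; have pn1 : pol (Rn n.+1) := hom_pol hn1.
rewrite (_ : R * _ = R * Rn n.+1 * c * adj (Rn n.+1)); last by rewrite !mulrA.
rewrite -(om_trace hd (hom_adj hn1)); last by in_pol.
rewrite !mulrA yb_product_conj -!mulrA (om_trace hd hn); last first.
  have pI := iter_can_endo_pol n pR.
  by in_pol.
have hx : hom n.+1 n.+1 (adj (Rn n) * c * Rn n).
  exact: (hom_mul HS (hom_mul HS (hom_adj hn) hc) hn).
rewrite (_ : _ * Rn n = iter n phi R * (adj (Rn n) * c * Rn n)); last by rewrite !mulrA.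
rewrite om_iter_right // !mulrA -(om_trace hd hn); last first.
  have pI := iter_can_endo_pol n pT.
  by in_pol.
rewrite !mulrA yb_product_move -(mulrA T).
by have [_ ->] := yb_product_unitary n; rewrite mulr1.
Qed.

(** Tracing out the last leg of [R_(n+1)] leaves [phi^n(T)], which slides
    through [R_n] to become one more factor [T] on the left. *)
Lemma om_yb_product_pow n k : om (T ^+ k * Rn n) = om (T ^+ (n + k)).
Proof.
elim: n k => [|n IH] k; first by rewrite yb_product0 mulr1.
have hn := yb_product_hom n; have pn : pol (Rn n) := hom_pol hn.
have hTk : hom n.+1 n.+1 (T ^+ k).
  elim: n {IH hn pn} => [|n IHn]; [exact: hom_exp | exact: hom_lift].
have pRI := iter_can_endo_pol n pR; have pTI := iter_can_endo_pol n pT.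
have hx : hom n.+1 n.+1 (T ^+ k * Rn n) by apply: hom_mul hTk hn.
rewrite yb_productSr mulrA (om_trace hd hx) // om_iter_right //.
by rewrite -(om_trace hd hx) // -mulrA yb_product_move mulrA -exprSr IH addnS.
Qed.

End Products.

Lemma left_inverse_yb R T L ph : yb_traces R T L ->
  omega_left_inverse D R ph -> ph R = T.
Proof.
move=> RTL phP; have hR := yb_hom RTL.
apply: (left_inverse_eq hd (kms_hom hd hR) phP (hom_pol hR) (hom_pol (yb_homT RTL))).
by move=> lam lamP mu nu; exact: (om_R_lam RTL mu nu lamP).
Qed.

Local Notation F := (cuntz_flip S).

Lemma flip_S i : F * S i = phi (S i).
Proof.
rewrite mulr_suml; apply: eq_bigr => j _; rewrite mulr_suml (bigD1 i) //= big1.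
  by rewrite addr0 -mulrA adjSS // eqxx mulr1.
by move=> k ki; rewrite -mulrA adjSS // (negPf ki) mulr0.
Qed.

Lemma flip_SS i j : F * S i * S j = S j * S i.
Proof. by rewrite flip_S can_endo_S. Qed.

Lemma flip_hom : hom 2 2 F.
Proof.
apply: lspan_sum => i _; apply: lspan_sum => j _.
have := hom_monomial S [:: i; j] [:: j; i].
by rewrite /monomial !word_cons word_nil !mulr1 adjM !mulrA.
Qed.

Lemma flip_adj : adj F = F.
Proof.
rewrite adj_sum; under eq_bigr do rewrite adj_sum.
rewrite exchange_big; apply: eq_bigr => i _; apply: eq_bigr => j _.
by rewrite !adjM !adjK !mulrA.
Qed.

(** The average of the compressions by the isometries: the normalised left
    partial trace. *)
Definition compress y : bop H := q^-1 *: \sum_k adj (S k) * y * S k.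

Lemma compress_pol y : pol y -> pol (compress y).
Proof.
move=> py; have pS k : pol (S k) by apply: pol_S.
by apply: lspanZ; apply: lspan_sum => k _; rewrite -/(pol _); in_pol.
Qed.

(** The scaling relation makes [compress] the adjoint of the shift. *)
Lemma om_compress y c : pol y -> pol c -> om (y * phi c) = om (compress y * c).
Proof.
move=> py pc; have pS k : pol (S k) by apply: pol_S.
rewrite bop_scaleAl omZ mulr_suml om_sum mulr_sumr mulr_sumr om_sum.
apply: eq_bigr => k _.
have [_ _ kk] := kms_adj (kms_S D hd k).
rewrite -!mulrA kk; last by in_pol.
by rewrite invrK [RHS]mulrA mulVf ?d_neq0 // mul1r !mulrA.
Qed.

(** [lambda_F] is the shift on polynomials. *)
Lemma left_inverse_flip ph y : omega_left_inverse D F ph -> pol y ->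
  ph y = compress y.
Proof.
move=> phP py.
apply: (left_inverse_eq hd (kms_hom hd flip_hom) phP py (compress_pol py)).
move=> lam lamP mu nu.
have lw l : lam (word l) = phi (word l).
  rewrite (lam_word lamP); elim: l => [|i l IH]; first by rewrite big_nil word_nil can_endo1.
  by rewrite big_cons IH flip_S word_cons can_endoM.
rewrite (star_hom_monomial _ _ (M_star D) (@M_S _ _ _ D) (lam_hom lamP)) !lw.
rewrite -can_endo_adj -can_endoM // -/(monomial S mu nu).
by rewrite om_compress //; apply: pol_monomial.
Qed.

End YangBaxter.

(** * Matrices as operators *)

Section MatrixUnits.
Local Open Scope sesquilinear_scope.
Variables (K : realType) (H : hilbertType K).
Local Notation C := K[i].

(** The embedding of [M_n] along a family of isometries with orthogonal ranges
    adding up to [1]. *)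
Definition toM n (V : 'I_n -> bop H) (A : 'M[C]_n) : bop H :=
  \sum_i \sum_j A i j *: (V i * adj (V j)).

Section Family.
Variables (n : nat) (V : 'I_n -> bop H).
Hypothesis HV : cuntz_relations V.
Implicit Types A B : 'M[C]_n.

Lemma toM_lin a A B : toM V (a *: A + B) = a *: toM V A + toM V B.
Proof.
rewrite scaler_sumr -big_split; apply: eq_bigr => i _ /=.
rewrite scaler_sumr -big_split; apply: eq_bigr => j _ /=.
by rewrite !mxE scalerDl scalerA.
Qed.

Lemma toM0 : toM V 0 = 0.
Proof. by rewrite /toM big1 // => i _; rewrite big1 // => j _; rewrite mxE scale0r. Qed.

Lemma toMZ a A : toM V (a *: A) = a *: toM V A.
Proof. by have := toM_lin a A 0; rewrite toM0 !addr0. Qed.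

Lemma toM1 : toM V 1%:M = 1.
Proof.
rewrite -[RHS](sum_SS HV); apply: eq_bigr => i _.
rewrite (bigD1 i) //= big1 => [|j ji]; first by rewrite mxE eqxx scale1r addr0.
by rewrite mxE eq_sym (negPf ji) scale0r.
Qed.

Lemma toM_adj A : adj (toM V A) = toM V (A ^t*).
Proof.
rewrite adj_sum; under eq_bigr do rewrite adj_sum.
rewrite exchange_big; apply: eq_bigr => i _; apply: eq_bigr => j _ /=.
by rewrite adjZ adjM adjK !mxE.
Qed.

Lemma toM_S A j : toM V A * V j = \sum_i A i j *: V i.
Proof.
rewrite mulr_suml; apply: eq_bigr => i _; rewrite mulr_suml (bigD1 j) //= big1.
  by rewrite addr0 bop_scaleAl -mulrA adjSS // eqxx mulr1.
by move=> k kj; rewrite bop_scaleAl -mulrA adjSS // (negPf kj) mulr0 scaler0.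
Qed.

Lemma toME A : toM V A = \sum_j toM V A * V j * adj (V j).
Proof. by under eq_bigr do rewrite -mulrA; rewrite -mulr_sumr (sum_SS HV) mulr1. Qed.

Lemma toMM A B : toM V (A *m B) = toM V A * toM V B.
Proof.
rewrite [LHS]toME [X in _ * X]toME mulr_sumr; apply: eq_bigr => k _.
rewrite !mulrA; congr (_ * _); rewrite -mulrA !toM_S mulr_sumr.
under [RHS]eq_bigr do rewrite bop_scaleAr toM_S scaler_sumr.
rewrite exchange_big; apply: eq_bigr => i _ /=.
by rewrite mxE scaler_suml; apply: eq_bigr => j _; rewrite scalerA mulrC.
Qed.

Lemma toM_coef A i j : adj (V i) * toM V A * V j = A i j *: (1 : bop H).
Proof.
rewrite -mulrA toM_S mulr_sumr (bigD1 i) //= big1 => [|k ki].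
  by rewrite addr0 bop_scaleAr adjSS // eqxx.
by rewrite bop_scaleAr adjSS // eq_sym (negPf ki) scaler0.
Qed.

Lemma toM_inj A B : (1 : bop H) != 0 -> toM V A = toM V B -> A = B.
Proof.
move=> one0 AB; apply/matrixP => i j; apply/eqP.
have /eqP := congr1 (fun x => adj (V i) * x * V j) AB.
rewrite !toM_coef -subr_eq0 -scalerBl scaler_eq0 subr_eq0.
by rewrite (negPf one0) orbF.
Qed.

Lemma toM_unitary A : A \is unitarymx -> unitary_op (toM V A).
Proof.
move=> uA; have AA := unitarymxP uA.
have AA' : A ^t* *m A = 1%:M.
  have := uA; rewrite -trmxC_unitary => /unitarymxP; by rewrite trmxCK.
by split; rewrite toM_adj -toMM ?AA ?AA' toM1.
Qed.

End Family.

Lemma toM_cast m n (e : m = n) (V : 'I_n -> bop H) (A : 'M[C]_m) :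
  toM V (castmx (e, e) A) = toM (fun i => V (cast_ord e i)) A.
Proof.
subst n; rewrite castmx_id; apply: eq_bigr => i _; apply: eq_bigr => j _.
by rewrite !cast_ord_id.
Qed.

Lemma eq_toM n (V W : 'I_n -> bop H) A : V =1 W -> toM V A = toM W A.
Proof.
by move=> VW; apply: eq_bigr => i _; apply: eq_bigr => j _; rewrite !VW.
Qed.

Definition tens_family m n (V : 'I_m -> bop H) (W : 'I_n -> bop H) p : bop H :=
  V (mxtens_unindex p).1 * W (mxtens_unindex p).2.

Lemma big_mxtens (T : zmodType) m n (F : 'I_(m * n) -> T) :
  \sum_p F p = \sum_i \sum_j F (mxtens_index (i, j)).
Proof.
rewrite pair_big /= (reindex (@mxtens_index m n)) /=.
  by apply: eq_bigr => -[i j].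
exists (@mxtens_unindex m n) => p _; [exact: mxtens_indexK | exact: mxtens_unindexK].
Qed.

Lemma tens_familyE m n (V : 'I_m -> bop H) (W : 'I_n -> bop H) i j :
  tens_family V W (mxtens_index (i, j)) = V i * W j.
Proof. by rewrite /tens_family mxtens_indexK. Qed.

Lemma tens_family_cuntz m n (V : 'I_m -> bop H) (W : 'I_n -> bop H) :
  cuntz_relations V -> cuntz_relations W -> cuntz_relations (tens_family V W).
Proof.
move=> HV HW; split.
  move=> p r; case: (mxtens_indexP p) => i j; case: (mxtens_indexP r) => k l.
  rewrite !tens_familyE adjM -mulrA (mulrA (adj (V i))) adjSS //.
  rewrite (can_eq (@mxtens_indexK m n)) xpair_eqE.
  by case: (i == k); rewrite ?mul1r ?adjSS // mul0r mulr0.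
rewrite big_mxtens -[RHS](sum_SS HV); apply: eq_bigr => i _.
under eq_bigr do rewrite tens_familyE adjM mulrA -(mulrA (V i)).
by rewrite -mulr_suml -mulr_sumr (sum_SS HW) mulr1.
Qed.

Lemma toM_tens m n (V : 'I_m -> bop H) (W : 'I_n -> bop H) (A : 'M[C]_m) (B : 'M[C]_n) :
  toM (tens_family V W) (A *t B) =
    \sum_i \sum_k A i k *: (V i * toM W B * adj (V k)).
Proof.
rewrite /toM big_mxtens; apply: eq_bigr => i _.
under eq_bigr do rewrite big_mxtens.
rewrite exchange_big; apply: eq_bigr => k _ /=.
rewrite mulr_sumr mulr_suml scaler_sumr; apply: eq_bigr => j _.
rewrite mulr_sumr mulr_suml scaler_sumr; apply: eq_bigr => l _.
by rewrite !tens_familyE tensmxE adjM bop_scaleAr bop_scaleAl scalerA !mulrA.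
Qed.

End MatrixUnits.

Section RMatrixOperators.
Variables (K : realType) (H : hilbertType K) (d : nat) (D : cuntz_gns H d).
Hypothesis hd : (1 < d)%N.
Local Notation S := (cS D).
Local Notation om := (omega D).
Local Notation q := (d%:R : K[i]).
Local Notation pol := (pol S).
Local Notation hom := (hom S).
Local Notation phi := (can_endo S).
Local Notation F := (cuntz_flip S).
Local Notation S2 := (tens_family S S).
Implicit Types (A B : 'M[K[i]]_(d * d)).

Let HS : cuntz_relations S := cS_rel D.
Let HS2 : cuntz_relations S2 := tens_family_cuntz HS HS.

Lemma to_F2E A : to_F2 D A = toM S2 A.
Proof.
rewrite /toM big_mxtens; apply: eq_bigr => i _; apply: eq_bigr => j _.
rewrite big_mxtens; apply: eq_bigr => k _; apply: eq_bigr => l _.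
by rewrite !tens_familyE.
Qed.

Lemma to_F2_hom A : hom 2 2 (to_F2 D A).
Proof.
apply: lspan_sum => i _; apply: lspan_sum => j _.
apply: lspan_sum => k _; apply: lspan_sum => l _; apply: lspanZ.
have := hom_monomial S [:: i; j] [:: k; l].
by rewrite /monomial !word_cons word_nil !mulr1.
Qed.

Lemma toM_hom (M : 'M[K[i]]_d) : hom 1 1 (toM S M).
Proof.
apply: lspan_sum => i _; apply: lspan_sum => j _; apply: lspanZ.
by have := hom_monomial S [:: i] [:: j]; rewrite /monomial !word1.
Qed.

(** Both sides of the matrix equation are transported by one embedding of the
    matrices of size [d * d * d]: it turns tensoring with [1] on the right into
    the inclusion, and on the left into the shift. *)
Lemma to_F2_braid A : yang_baxter A ->
  to_F2 D A * phi (to_F2 D A) * to_F2 D A = phi (to_F2 D A) * to_F2 D A * phi (to_F2 D A).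
Proof.
pose S3 := tens_family S2 S.
have HS3 : cuntz_relations S3 := tens_family_cuntz HS2 HS.
have E1 : toM S3 (A *t 1%:M) = to_F2 D A.
  rewrite toM_tens to_F2E; apply: eq_bigr => i _; apply: eq_bigr => k _.
  by rewrite toM1 // mulr1.
have E2 : toM S3 (castmx (mulnA d d d, mulnA d d d) (1%:M *t A)) = phi (to_F2 D A).
  rewrite toM_cast (@eq_toM _ _ _ _ (tens_family S S2)) => [|p]; last first.
    case: (mxtens_indexP p) => i r; case: (mxtens_indexP r) => j k.
    have -> : cast_ord (mulnA d d d) (mxtens_index (i, mxtens_index (j, k))) =
              mxtens_index (mxtens_index (i, j), k).
      by apply: val_inj; rewrite /= mulnDl mulnA addnA.
    by rewrite /S3 !tens_familyE mulrA.
  rewrite toM_tens; apply: eq_bigr => i _; rewrite (bigD1 i) //= big1.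
    by rewrite mxE eqxx scale1r addr0 to_F2E.
  by move=> k ki; rewrite mxE eq_sym (negPf ki) scale0r.
move=> yb; have := congr1 (toM S3) yb.
by rewrite !toMM // E1 E2.
Qed.

Lemma block_coef (X : 'I_d -> 'I_d -> bop H) i j :
  adj (S i) * (\sum_k \sum_l S k * X k l * adj (S l)) * S j = X i j.
Proof.
rewrite mulr_sumr mulr_suml (bigD1 i) //= [X in _ + X]big1 => [|k ki].
  rewrite addr0 mulr_sumr mulr_suml (bigD1 j) //= big1 => [|l lj].
    by rewrite addr0 -!mulrA adjSS // eqxx mulr1 mulrA adjSS // eqxx mul1r.
  by rewrite -!mulrA adjSS // (negPf lj) !mulr0.
rewrite mulr_sumr mulr_suml big1 // => l _.
by rewrite !mulrA adjSS // eq_sym (negPf ki) !mul0r.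
Qed.

(** [compress] keeps the diagonal blocks over the first tensor factor. *)
Lemma compress_to_F2 A : compress D (to_F2 D A) = toM S (q^-1 *: ptrace_l A).
Proof.
rewrite toMZ; congr (_ *: _).
have blocks : to_F2 D A = \sum_i \sum_k S i *
    toM S (\matrix_(j, l) A (mxtens_index (i, j)) (mxtens_index (k, l))) * adj (S k).
  apply: eq_bigr => i _; rewrite exchange_big; apply: eq_bigr => k _ /=.
  rewrite mulr_sumr mulr_suml; apply: eq_bigr => j _.
  rewrite mulr_sumr mulr_suml; apply: eq_bigr => l _.
  by rewrite bop_scaleAr bop_scaleAl mxE adjM !mulrA.
under eq_bigr do rewrite blocks block_coef.
rewrite exchange_big; apply: eq_bigr => j _ /=.
rewrite exchange_big; apply: eq_bigr => l _ /=.
by rewrite mxE scaler_suml; apply: eq_bigr => k _; rewrite mxE.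
Qed.

Definition swap_index (p : 'I_(d * d)) : 'I_(d * d) :=
  mxtens_index ((mxtens_unindex p).2, (mxtens_unindex p).1).

Lemma swap_indexE i j : swap_index (mxtens_index (i, j)) = mxtens_index (j, i).
Proof. by rewrite /swap_index mxtens_indexK. Qed.

Definition swapmx A : 'M[K[i]]_(d * d) :=
  \matrix_(p, r) A (swap_index p) (swap_index r).

Lemma ptrace_l_swap A : ptrace_l (swapmx A) = ptrace_r A.
Proof.
by apply/matrixP => i k; rewrite !mxE; apply: eq_bigr => j _; rewrite mxE !swap_indexE.
Qed.

Lemma flip_conj A : F * to_F2 D A * F = to_F2 D (swapmx A).
Proof.
have sandwich (I : finType) (G : I -> bop H) : F * (\sum_i G i) * F = \sum_i F * G i * F.
  by rewrite (big_distrr F) (big_distrl F).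
rewrite [RHS]exchange_big sandwich; apply: eq_bigr => i _ /=.
rewrite sandwich; apply: eq_bigr => j _.
rewrite [RHS]exchange_big sandwich; apply: eq_bigr => k _ /=.
rewrite sandwich; apply: eq_bigr => l _.
rewrite bop_scaleAr bop_scaleAl mxE !swap_indexE; congr (_ *: _).
rewrite !mulrA flip_SS -!mulrA; do 2 congr (_ * _).
by rewrite -[F in LHS]flip_adj -adjM mulrA flip_SS.
Qed.

Lemma flipK : F * F = 1.
Proof.
have -> : F * F = \sum_i \sum_j S j * S i * adj (S i) * adj (S j).
  rewrite {2}/cuntz_flip (big_distrr F); apply: eq_bigr => i _ /=.
  rewrite (big_distrr F); apply: eq_bigr => j _ /=.
  by rewrite !mulrA flip_SS.
rewrite exchange_big -[RHS](sum_SS HS); apply: eq_bigr => j _ /=.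
rewrite -mulr_suml; congr (_ * _).
by under eq_bigr do rewrite -mulrA; rewrite -mulr_sumr (sum_SS HS) mulr1.
Qed.

(** Because [F S_i = phi(S_i)], conjugation by [F] sends the matrix unit
    [S_i S_j^*] to its shift. *)
Lemma flip_shift x : hom 1 1 x -> F * x * F = phi x.
Proof.
elim=> {x} [_ [mu [nu [sm sn ->]]]||a x y _ IHx _ IHy].
- case: mu sm => [|i [|? ?]] // _; case: nu sn => [|j [|? ?]] // _.
  rewrite /monomial !word1 mulrA flip_S -mulrA -[F in LHS]flip_adj -adjM flip_S.
  by rewrite -can_endo_adj -can_endoM.
- by rewrite mulr0 mul0r /can_endo big1 // => i _; rewrite mulr0 mul0r.
- by rewrite can_endo_lin -IHx -IHy mulrDr mulrDl bop_scaleAr bop_scaleAl.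
Qed.

Lemma om_toM (M : 'M[K[i]]_d) : om (toM S M) = q^-1 * \tr M.
Proof.
have omSS i j : om (S i * adj (S j)) = q^-1 *+ (i == j).
  have := @om_SxS _ _ _ D hd i j 1 (pol1 S); rewrite mulr1 => ->.
  by rewrite om1 // mulr1.
rewrite om_sum mulr_sumr; apply: eq_bigr => i _; rewrite om_sum (bigD1 i) //= big1.
  by rewrite addr0 omZ omSS eqxx mulrC.
by move=> j ji; rewrite omZ omSS eq_sym (negPf ji) mulr0.
Qed.

Lemma one_neq0 : (1 : bop H) != 0.
Proof.
by apply/eqP => /(congr1 om)/eqP; rewrite om0 om1 // oner_eq0.
Qed.

(** The left trace is [compress R]. The right trace is [compress (F R F)], and
    conjugating the test element by the flip brings it to the first tensor
    factor. *)
Lemma yb_traces_r_matrix A : r_matrix A ->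
  yb_traces D (to_F2 D A) (toM S (q^-1 *: ptrace_r A)) (toM S (q^-1 *: ptrace_l A)).
Proof.
move=> [uA yb]; have hA := to_F2_hom A; have pA : pol (to_F2 D A) := hom_pol hA.
have hF := flip_hom D; have pF : pol F := hom_pol hF.
split=> //.
- by rewrite to_F2E; apply: toM_unitary.
- exact: to_F2_braid.
- exact: toM_hom.
- exact: toM_hom.
- move=> x hx; have px : pol x := hom_pol hx.
  rewrite -ptrace_l_swap -compress_to_F2 -flip_conj -om_compress //; last by in_pol.
  rewrite -(flip_shift hx) -!mulrA (mulrA F F) flipK mul1r.
  by rewrite (om_trace hd hF) -?mulrA ?flipK ?mulr1 //; in_pol.
- by move=> x px; rewrite om_compress // compress_to_F2.
Qed.

Lemma hnorm_sum_le n (X : 'I_n -> bop H) (v : H) (c : K) :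
  (forall k, hnorm (X k v) <= c) -> hnorm ((\sum_k X k) v) <= n%:R * c.
Proof.
elim: n X => [|n IH] X Xc; first by rewrite big_ord0 bopE_zero hnorm0 mul0r.
rewrite big_ord_recl bopE_add -natr1 mulrDl mul1r addrC.
by apply: le_trans (Defs.hnormD _ _) _; apply: lerD => //; apply: IH.
Qed.

(** Each [S_k^* u S_k] is an isometry, followed by a unitary and by the adjoint of
    an isometry. *)
Lemma compress_contraction (u : bop H) : unitary_op u -> opnorm (compress D u) <= 1.
Proof.
move=> [u1 _]; apply: opnorm_le => // v; rewrite mul1r bopE_scale.
have -> : q^-1 = ((d%:R : K)^-1)%:C by rewrite fmorphV rmorph_nat.
rewrite hnormZR ?invr_ge0 ?ler0n //.
have d0 : 0 < d%:R :> K by rewrite ltr0n (ltn_trans _ hd).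
rewrite mulrC ler_pdivrMr // mulrC; apply: hnorm_sum_le => k.
rewrite !bopE_mul.
apply: le_trans (hnorm_coisometry _ _) _; first by rewrite adjSS // eqxx.
by rewrite hnorm_isometry // hnorm_isometry // adjSS // eqxx.
Qed.

End RMatrixOperators.

(** * Unitary similarity of normal matrices *)

Section NormalSimilarity.
Local Open Scope sesquilinear_scope.
Variable C : numClosedFieldType.

(** The sums of [p(a_i)] and [p(b_i)] agree for every polynomial [p]; one that
    vanishes at all values but one counts the occurrences of that value. *)
Lemma power_sums_perm n (a b : 'I_n -> C) :
  (forall k, \sum_i a i ^+ k = \sum_i b i ^+ k) ->
  exists s : 'S_n, forall i, a i = b (s i).
Proof.
move=> ab.
have abp (p : {poly C}) : \sum_i p.[a i] = \sum_i p.[b i].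
  under eq_bigr do rewrite horner_coef.
  under [RHS]eq_bigr do rewrite horner_coef.
  rewrite exchange_big [RHS]exchange_big; apply: eq_bigr => k _ /=.
  by rewrite -!mulr_sumr ab.
have perm : perm_eq [tuple a i | i < n] [tuple b i | i < n].
  apply/allP => c _ /=; apply/eqP.
  pose vals := [seq v <- undup (codom a ++ codom b) | v != c].
  pose p : {poly C} := \prod_(v <- vals) ('X - v%:P).
  have pc : p.[c] != 0.
    rewrite -rootE root_prod_XsubC mem_filter eqxx //.
  have pv f : (forall i, f i \in codom a ++ codom b) ->
      \sum_i p.[f i] = p.[c] *+ count_mem c [tuple f i | i < n].
    move=> fab; rewrite -sum1_count big_map big_enum_cond /= -sumrMnr.
    rewrite [RHS]big_mkcond /=; apply: eq_bigr => i _.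
    case: eqVneq => [->|fc]; first by rewrite mulr1n.
    by apply/eqP; rewrite -rootE root_prod_XsubC mem_filter fc mem_undup fab.
  have := abp p; rewrite !pv; last first.
  - by move=> i; rewrite mem_cat codom_f.
  - by move=> i; rewrite mem_cat codom_f orbT.
  rewrite -mulr_natr -[RHS]mulr_natr => /(mulfI pc)/eqP.
  by rewrite eqr_nat => /eqP.
have /tuple_permP[s /= E] := perm.
exists s => i; have /(_ i) := (eq_in_map _ _ _).2 E.
by rewrite mem_enum tnth_mktuple => ->.
Qed.

Lemma spectral_mxtrace_exp n (A P : 'M[C]_n) (sp : 'rV[C]_n) k :
  P \in unitmx -> A = invmx P *m diag_mx sp *m P ->
  \tr (A ^+ k) = \sum_i sp 0 i ^+ k.
Proof.
move=> uP ->.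
have -> : (invmx P *m diag_mx sp *m P) ^+ k =
    invmx P *m diag_mx (\row_i sp 0 i ^+ k) *m P.
  elim: k => [|k IH].
    rewrite expr0 -[LHS](mulVmx uP) -[in LHS](mulmx1 (invmx P)); congr (_ *m _ *m _).
    by apply/matrixP => i j; rewrite !mxE expr0.
  rewrite exprS IH -[_ * _]/(_ *m _) !mulmxA; congr (_ *m _).
  rewrite -!mulmxA (mulmxA P) mulmxV // mul1mx; congr (_ *m _).
  rewrite mulmx_diag; congr diag_mx; apply/rowP => i.
  by rewrite !mxE exprS.
rewrite -mulmxA mxtrace_mulC -mulmxA mulmxV // mulmx1 mxtrace_diag.
by apply: eq_bigr => i _; rewrite mxE.
Qed.

(** Both matrices are diagonal in suitable orthonormal bases. Equal power traces
    make the eigenvalues agree up to a permutation, which is implemented by a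
    permutation matrix. *)
Lemma normal_unitary_similar n (A B : 'M[C]_n) :
    A \is normalmx -> B \is normalmx ->
    (forall k, \tr (A ^+ k) = \tr (B ^+ k)) ->
  exists2 U : 'M[C]_n, U \is unitarymx & A = U *m B *m U ^t*.
Proof.
move=> /orthomx_spectralP EA /orthomx_spectralP EB trAB.
set P := spectralmx A in EA; set Q := spectralmx B in EB.
have uP : P \is unitarymx := spectral_unitarymx A.
have uQ : Q \is unitarymx := spectral_unitarymx B.
have [s st] : exists s : 'S_n, forall i, spectral_diag A 0 i = spectral_diag B 0 (s i).
  apply: power_sums_perm => k.
  rewrite -(spectral_mxtrace_exp k (unitarymx_unit uP) EA).
  by rewrite -(spectral_mxtrace_exp k (unitarymx_unit uQ) EB).
have us : (perm_mx s : 'M[C]_n) \is unitarymx.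
  apply/unitarymxP; rewrite tr_perm_mx map_perm_mx -perm_mxM mulgV.
  exact: perm_mx1.
have Ds : diag_mx (spectral_diag A) =
    perm_mx s *m diag_mx (spectral_diag B) *m (perm_mx s) ^t*.
  rewrite tr_perm_mx map_perm_mx -col_permE -row_permE; apply/matrixP => i j.
  by rewrite !mxE st (inj_eq perm_inj).
exists (P ^t* *m perm_mx s *m Q).
  by do ?[apply: mul_unitarymx] => //; rewrite trmxC_unitary.
rewrite [LHS]EA Ds [in RHS]EB !invmx_unitary // !trmx_mul !map_mxM trmxCK !mulmxA.
by rewrite !mulmxtVK.
Qed.

End NormalSimilarity.

(** * Ultraweakly continuous functionals along weak limits *)

Section NormalLimits.
Variables (K : realType) (H : hilbertType K).
Implicit Types (v w : H) (x : bop H).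
Local Notation normc := (@Normc.normc K).

Lemma normc_ge0 z : 0 <= normc z.
Proof. by rewrite -lecR; exact: (normr_ge0 z). Qed.

Lemma normc_sum_le n (F : 'I_n -> K[i]) (G : 'I_n -> K) :
  (forall k, normc (F k) <= G k) -> normc (\sum_k F k) <= \sum_k G k.
Proof.
move=> FG; apply: (big_ind2 (fun (z : K[i]) (r : K) => normc z <= r)) => //.
  by rewrite Normc.normc0.
by move=> z1 r1 z2 r2 h1 h2; apply: le_trans (le_normcD _ _) (lerD h1 h2).
Qed.

Lemma hnorm_scale (a : K[i]) v : hnorm (a *: v) = normc a * hnorm v.
Proof.
apply/eqP; rewrite -(@eqrXn2 _ 2) ?mulr_ge0 ?hnorm_ge0 ?normc_ge0 //.
apply/eqP/complexI; rewrite -hdot_hnorm hdotZl hdotZr hdot_hnorm mulrA.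
by rewrite [Num.conj a * a]mulrC -normCK -[`|a|]/((normc a)%:C) exprMn !expr2 !rmorphM.
Qed.

(** Reduced to the inequality for real parts by rotating [w] with the conjugate
    of the inner product. *)
Lemma cauchy_schwarzC v w : normc (hdot v w) <= hnorm v * hnorm w.
Proof.
set z := hdot v w; have [->|z0] := eqVneq (normc z) 0.
  by rewrite mulr_ge0 ?hnorm_ge0.
have zp : 0 < normc z by rewrite lt_def z0 normc_ge0.
have := cauchy_schwarz v (Num.conj z *: w).
rewrite hdotZr -/z mulrC -normCK -[`|z|]/((normc z)%:C) hnorm_scale.
have -> : normc (Num.conj z) = normc z.
  by apply: complexI; exact: (norm_conjC z).
by rewrite -rmorphXn /= expr2 mulrCA ler_pM2l.
Qed.

Lemma sq_summable_tail (xi : nat -> H) (e : K) : sq_summable xi -> 0 < e ->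
  exists k0, forall k1 n, (k0 <= k1)%N -> (k1 <= n)%N ->
    \sum_(k1 <= k < n) hnorm (xi k) ^+ 2 < e.
Proof.
move=> [c hc] e0; pose s n := \sum_(0 <= k < n) hnorm (xi k) ^+ 2.
have sc n : s n <= c by rewrite /s big_mkord.
have sup_s : has_sup (range s).
  by split; [exists (s 0%N), 0%N | exists c => _ [n _ <-]].
have [_ [k0 _ <-] hk0] := sup_adherent e0 sup_s.
exists k0 => k1 n k01 k1n.
have sn : s n <= sup (range s) by apply: ub_le_sup; [case: sup_s | exists n].
have s01 : s k0 <= s k1.
  rewrite /s (@big_cat_nat _ _ _ k0 0 k1) //= lerDl.
  by apply: sumr_ge0 => k _; apply: sqr_ge0.
have : s n = s k1 + \sum_(k1 <= k < n) hnorm (xi k) ^+ 2 by apply: big_cat_nat.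
by lra.
Qed.

Lemma eventually_all (n : nat) (P : nat -> nat -> Prop) :
  (forall k, exists N, forall m, (N <= m)%N -> P k m) ->
  exists N, forall m, (N <= m)%N -> forall k, (k < n)%N -> P k m.
Proof.
move=> hP; elim: n => [|n [N hN]]; first by exists 0%N.
have [N' hN'] := hP n; exists (maxn N N') => m; rewrite geq_max => /andP[m1 m2] k.
by rewrite ltnS leq_eqVlt => /orP[/eqP ->|kn]; [apply: hN' | apply: hN].
Qed.

(** An ultraweakly continuous functional passes to the limit along a bounded
    sequence converging weakly to a scalar: the tails of the series that
    represents it are small uniformly on bounded sets. *)
Lemma normal_functional_limit (A : set (bop H)) (g : bop H -> K[i])
    (u : nat -> bop H) (c delta : K[i]) (b : K) :
    normal_functional A g -> A 1 -> (forall n, A (u n)) -> 0 <= b ->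
    (forall n v, hnorm ((u n - c *: (1 : bop H)) v) <= b * hnorm v) ->
    (forall v w (e : K), 0 < e -> exists N, forall n, (N <= n)%N ->
       normc (hdot v ((u n - c *: (1 : bop H)) w)) < e) ->
    (forall n, g (u n) = delta) -> delta = c * g 1.
Proof.
move=> [xi [eta [sxi seta hg]]] A1 Au b0 ub uw gu.
apply/eqP; rewrite -subr_eq0; apply/eqP/Normc.eq0_normc.
set Delta := delta - c * g 1; apply/eqP; rewrite eq_le normc_ge0 andbT.
apply/ler_addgt0Pl => e e0; rewrite addr0.
have b2 : 0 < b + 1 by rewrite ltr_wpDl.
have e1 : 0 < e / 4 / (b + 1) by rewrite !divr_gt0.
have [kx hx] := sq_summable_tail sxi e1.
have [ky hy] := sq_summable_tail seta e1.
pose k1 := maxn kx ky.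
pose f n N := \sum_(k < N) hdot (xi k) ((u n - c *: (1 : bop H)) (eta k)).
have e2 : 0 < e / 4 / k1.+1%:R by rewrite !divr_gt0 // ltr0n.
have [n hn] := eventually_all k1 (fun k => uw (xi k) (eta k) _ e2).
have {}hn := hn n (leqnn n).
have fhead : normc (f n k1) <= e / 4.
  apply: le_trans (normc_sum_le (G := fun=> e / 4 / k1.+1%:R) _) _.
    by move=> k; apply: ltW; apply: hn.
  rewrite sumr_const card_ord -[leLHS]mulr_natr mulrAC ler_pdivrMr ?ltr0n //.
  by rewrite ler_wpM2l ?ler_nat // divr_ge0 // ltW.
have ftail N : (k1 <= N)%N -> normc (f n N - f n k1) <= e / 4.
  move=> kN; have -> : f n N - f n k1 =
      \sum_(k1 <= k < N) hdot (xi k) ((u n - c *: (1 : bop H)) (eta k)).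
    rewrite /f -(big_mkord xpredT (fun k => hdot (xi k) ((u n - c *: (1 : bop H)) (eta k)))).
    rewrite -(big_mkord xpredT (fun k => hdot (xi k) ((u n - c *: (1 : bop H)) (eta k)))).
    by rewrite (@big_cat_nat _ _ _ k1 0 N) //= addrAC subrr add0r.
  have le1 : normc (\sum_(k1 <= k < N) hdot (xi k) ((u n - c *: (1 : bop H)) (eta k))) <=
      \sum_(k1 <= k < N) (b / 2 * hnorm (xi k) ^+ 2 + b / 2 * hnorm (eta k) ^+ 2).
    apply: (big_ind2 (fun (z : K[i]) (r : K) => normc z <= r)).
    - by rewrite Normc.normc0.
    - by move=> z1 r1 z2 r2 h1 h2; apply: le_trans (le_normcD _ _) (lerD h1 h2).
    - move=> k _; apply: le_trans (cauchy_schwarzC _ _) _.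
      apply: le_trans (ler_wpM2l (hnorm_ge0 _) (ub n _)) _.
      have := sqr_ge0 (hnorm (xi k) - hnorm (eta k)); rewrite sqrrB => sq.
      rewrite -mulrDr mulrCA -mulrA; apply: ler_wpM2l => //.
      by rewrite mulr2n in sq; lra.
  apply: le_trans le1 _; rewrite big_split /= -!mulr_sumr -mulrDr.
  have h1 := hx k1 N (leq_maxl _ _) kN; have h2 := hy k1 N (leq_maxr _ _) kN.
  apply: le_trans (_ : b / 2 * (e / 4 / (b + 1) + e / 4 / (b + 1)) <= _).
    by rewrite ler_wpM2l ?divr_ge0 // lerD // ltW.
  have -> : b / 2 * (e / 4 / (b + 1) + e / 4 / (b + 1)) = e / 4 * (b / (b + 1)).
    by field; rewrite gt_eqF.
  by rewrite ler_piMr ?divr_ge0 ?(ltW e0) // ler_pdivrMr // mul1r lerDl.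
have c2 : 0 < normc c + 1 by rewrite ltr_wpDl ?normc_ge0.
have e3 : 0 < e / 4 / (normc c + 1) by rewrite !divr_gt0.
have [N1 hN1] := hg _ (Au n) _ e3; have [N2 hN2] := hg _ A1 _ e3.
pose N := maxn k1 (maxn N1 N2).
have kN : (k1 <= N)%N by apply: leq_maxl.
have N1N : (N1 <= N)%N by rewrite /N !leq_max leqnn !orbT.
have N2N : (N2 <= N)%N by rewrite /N !leq_max leqnn !orbT.
have {}hN1 := hN1 _ N1N; have {}hN2 := hN2 _ N2N.
have flim : normc (Delta - f n N) <= e / 4.
  have fE : f n N = \sum_(k < N) hdot (xi k) (u n (eta k))
      - c * \sum_(k < N) hdot (xi k) ((1 : bop H) (eta k)).
    rewrite /f mulr_sumr -sumrB; apply: eq_bigr => k _.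
    by rewrite bopE_add bopE_opp bopE_scale hdotDr hdotNr hdotZr.
  set s1 := \sum_(k < N) _ in hN1 fE; set s2 := \sum_(k < N) _ in hN2 fE.
  rewrite -[`|_|]/((normc _)%:C) ltcR gu in hN1.
  rewrite -[`|_|]/((normc _)%:C) ltcR in hN2.
  have -> : Delta - f n N = - (s1 - delta) + c * (s2 - g 1) by rewrite fE /Delta; ring.
  apply: le_trans (le_normcD _ _) _; rewrite Normc.normcM.
  have -> : normc (- (s1 - delta)) = normc (s1 - delta).
    exact: normcN.
  apply: le_trans (_ : e / 4 / (normc c + 1) + normc c * (e / 4 / (normc c + 1)) <= _).
    by rewrite lerD ?ler_wpM2l ?normc_ge0 // ltW.
  by rewrite le_eqVlt; apply/orP; left; apply/eqP; field; rewrite gt_eqF.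
have -> : Delta = (Delta - f n N) + ((f n N - f n k1) + f n k1) by ring.
apply: le_trans (le_normcD _ _) _.
have := le_normcD (f n N - f n k1) (f n k1); have := ftail _ kN.
lra.
Qed.

End NormalLimits.

(** * Mixing of the shift *)

Section Mixing.
Variables (K : realType) (H : hilbertType K) (d : nat) (D : cuntz_gns H d).
Hypothesis hd : (1 < d)%N.
Local Notation S := (cS D).
Local Notation om := (omega D).
Local Notation Om := (gns_Omega D).
Local Notation q := (d%:R : K[i]).
Local Notation pol := (pol S).
Local Notation hom := (hom S).
Local Notation phi := (can_endo S).
Local Notation normc := (@Normc.normc K).
Implicit Types (x y z a b c : bop H) (mu nu : seq 'I_d).

Let HS : cuntz_relations S := cS_rel D.

Lemma om_iter_can_endo n x : pol x -> om (iter n phi x) = om x.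
Proof.
move=> px; elim: n => //= n IH; rewrite (om_can_endo hd) //.
exact: iter_can_endo_pol.
Qed.

(** Peeling the first letters off both words lowers the shift by one and
    multiplies both sides by the same factor. *)
Lemma mixing_monomial m x mu nu n : hom m m x -> (size mu <= n)%N ->
  om (iter n phi x * monomial S mu nu) = om x * om (monomial S mu nu).
Proof.
move=> hx; have px : pol x := hom_pol hx.
have [smn|smn] := eqVneq (size mu) (size nu); last first.
  move=> _; rewrite (om_monomial_size D smn) mulr0.
  have := kmsM (kms_hom hd (iter_can_endo_hom n hx)) (kms_monomial D hd mu nu).
  by rewrite mul1r => k; apply: (kms_offdiag hd k).
elim: mu nu n smn => [|i mu IH] [|j nu] // n smn.
  by move=> _; rewrite /monomial word_nil adj1 !mulr1 om1 // mulr1 om_iter_can_endo.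
case: n => // n; rewrite ltnS => mn; case: smn => smn.
have pm := pol_monomial S mu nu; have pn := iter_can_endo_pol n px.
have -> : iter n.+1 phi x * monomial S (i :: mu) (j :: nu) =
    S i * (iter n phi x * monomial S mu nu) * adj (S j).
  by rewrite monomial_cons /= !mulrA can_endo_S.
rewrite monomial_cons !om_SxS //; last by in_pol.
by rewrite IH // mulrnAr mulrCA.
Qed.

Lemma mixing_pol m x c : hom m m x -> pol c ->
  exists N, forall n, (N <= n)%N -> om (iter n phi x * c) = om x * om c.
Proof.
move=> hx; elim=> {c} [_ [mu [nu ->]]||r a b _ [N1 h1] _ [N2 h2]].
- by exists (size mu) => n; apply: mixing_monomial hx.
- by exists 0%N => n _; rewrite mulr0 om0 mulr0.
- exists (maxn N1 N2) => n; rewrite geq_max => /andP[n1 n2].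
  by rewrite mulrDr bop_scaleAr !omD !omZ h1 // h2 //; ring.
Qed.

Lemma mixing_sandwich m x a b : hom m m x -> pol a -> pol b ->
  exists N, forall n, (N <= n)%N -> om (a * iter n phi x * b) = om x * om (a * b).
Proof.
move=> hx pa pb; have px : pol x := hom_pol hx.
elim: pa => {a} [_ [mu [nu ->]]||r a c _ [N1 h1] _ [N2 h2]].
- have [_ pm kk] := kms_monomial D hd mu nu.
  have [N hN] := mixing_pol hx (pol_mul HS pb pm).
  exists N => n /hN hn; have pn := iter_can_endo_pol n px.
  rewrite -mulrA kk; last by in_pol.
  by rewrite -mulrA hn [in RHS]kk // mulrCA.
- by exists 0%N => n _; rewrite !mul0r om0 mulr0.
- exists (maxn N1 N2) => n; rewrite geq_max => /andP[n1 n2].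
  by rewrite !mulrDl !bop_scaleAl !omD !omZ h1 // h2 //; ring.
Qed.

Lemma scalar_shift_bound x n v : adj x * x = 1 ->
  hnorm ((iter n phi x - om x *: (1 : bop H)) v) <= (1 + normc (om x)) * hnorm v.
Proof.
move=> x1; rewrite bopE_add bopE_opp bopE_scale bopE_one.
apply: le_trans (Defs.hnormD _ _) _; rewrite hnormN hnorm_scale mulrDl mul1r lerD //.
by rewrite hnorm_isometry // -iter_can_endo_adj -iter_can_endoM // x1 iter_can_endo1.
Qed.

(** The shift is mixing: [phi^n(x)] tends weakly to the scalar [omega(x)]. On
    polynomial vectors the matrix coefficients are eventually constant; density
    and boundedness do the rest. *)
Lemma mixing_weak m x : hom m m x -> adj x * x = 1 -> forall v w (e : K), 0 < e ->
  exists N, forall n, (N <= n)%N ->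
    normc (hdot v ((iter n phi x - om x *: (1 : bop H)) w)) < e.
Proof.
move=> hx x1 v w e e0; set C := 1 + normc (om x).
have C0 : 0 < C by rewrite ltr_wpDr ?normc_ge0.
have wb n u : hnorm ((iter n phi x - om x *: (1 : bop H)) u) <= C * hnorm u.
  exact: scalar_shift_bound.
have e1 : 0 < e / 2 / (C * (hnorm w + 1)).
  by rewrite !divr_gt0 // mulr_gt0 // ltr_wpDl ?hnorm_ge0.
have [a pa av] := dense_pol D v e1.
have e2 : 0 < e / 2 / (C * (hnorm (a Om) + 1)).
  by rewrite !divr_gt0 // mulr_gt0 // ltr_wpDl ?hnorm_ge0.
have [b pb bw] := dense_pol D w e2.
have [N hN] := mixing_sandwich hx (pol_adj pa) pb.
exists N => n /hN hn; set t := iter n phi x - _.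
have ab0 : hdot (a Om) (t (b Om)) = 0.
  rewrite hdot_adjr -!bopE_mul -[hdot _ _]/(om _).
  rewrite /t mulrBr mulrBl bop_scaleAr bop_scaleAl mulr1 omB omZ.
  by rewrite hn subrr.
have -> : hdot v (t w) = hdot (v - a Om) (t w) + hdot (a Om) (t (w - b Om)).
  by rewrite -[- b Om]scaleN1r bopD bopZ scaleN1r hdotDr hdotNr ab0 hdotDl hdotNl; ring.
apply: le_lt_trans (le_normcD _ _) _.
have h1 : normc (hdot (v - a Om) (t w)) <= hnorm (v - a Om) * (C * hnorm w).
  exact: le_trans (cauchy_schwarzC _ _) (ler_wpM2l (hnorm_ge0 _) (wb n _)).
have h2 : normc (hdot (a Om) (t (w - b Om))) <= hnorm (a Om) * (C * hnorm (w - b Om)).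
  exact: le_trans (cauchy_schwarzC _ _) (ler_wpM2l (hnorm_ge0 _) (wb n _)).
have h1' : hnorm (v - a Om) * (C * hnorm w) <= e / 2.
  rewrite hnormBC; apply: le_trans (_ : hnorm (a Om - v) * (C * (hnorm w + 1)) <= _).
    by rewrite ler_wpM2l ?hnorm_ge0 // ler_pM2l // lerDl.
  by rewrite -ler_pdivlMr ?ltW // mulr_gt0 // ltr_wpDl ?hnorm_ge0.
have h2' : hnorm (a Om) * (C * hnorm (w - b Om)) < e / 2.
  rewrite hnormBC.
  apply: le_lt_trans (_ : (hnorm (a Om) + 1) * (C * hnorm (b Om - w)) < _).
    by rewrite ler_wpM2r ?lerDl // mulr_ge0 ?hnorm_ge0 // ltW.
  rewrite mulrA [_ * C]mulrC [ltLHS]mulrC -ltr_pdivlMr //.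
  by rewrite mulr_gt0 // ltr_wpDl ?hnorm_ge0.
lra.
Qed.

Lemma om_normal A : normal_functional A om.
Proof.
pose xi k := if k == 0%N then Om else 0.
have sxi : sq_summable xi.
  exists (hnorm Om ^+ 2) => -[|n]; first by rewrite big_ord0 sqr_ge0.
  rewrite big_ord_recl big1 ?addr0 // => i _.
  by rewrite /xi /= hnorm0 expr0n.
exists xi, xi; split=> // x _ e e0; exists 1%N => -[//|n] _.
rewrite big_ord_recl big1 => [|i _]; last by rewrite /xi /= hdot0l.
by rewrite addr0 subrr normr0 -[0]/(0%:C) ltcR.
Qed.

(** An isomorphism intertwining the shifts preserves the trace: it is normal,
    and the shift is mixing, so [omega o gamma] takes the value [omega(x)] on
    the weak limit of [phi^n(x)], while it is constant along that sequence. *)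
Lemma yb_equiv_om R T L R' T' L' n :
  yb_traces D R T L -> yb_traces D R' T' L' -> yb_equiv D R R' ->
  om (yb_product D R n) = om (yb_product D R' n).
Proof.
move=> hR hR' [gam [[gh _ gn] gR gphi]].
have sL := vN_generated_star [set iter k phi R | k in [set: nat]].
have LR k : L_alg D R (iter k phi R) by apply: sub_vN_generated; exists k.
have gRk k : gam (iter k phi R) = iter k phi R'.
  by elim: k => //= k IH; rewrite -gphi ?IH.
have iter_prod (Q : bop H) k : iter k phi (yb_product D Q n) = \prod_(j < n) iter (k + j) phi Q.
  elim: k => //= k ->; rewrite can_endo_prod //.
have Lk k : L_alg D R (iter k phi (yb_product D R n)).
  by rewrite iter_prod; apply: star_subalgebra_prod => // j; apply: LR.
have gamk k : gam (iter k phi (yb_product D R n)) = iter k phi (yb_product D R' n).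
  rewrite !iter_prod (star_hom_prod sL gh) // => [|j]; last exact: LR.
  by apply: eq_bigr => j _.
have hP := yb_product_hom hR n; have hP' := yb_product_hom hR' n.
have [U1 _] := yb_product_unitary hR n.
have C0 : 0 <= 1 + normc (om (yb_product D R n)) by rewrite addr_ge0 ?normc_ge0.
have [L1 _ _ _] := sL; have [_ _ g1 _ _] := gh.
have := normal_functional_limit (gn _ (@om_normal _)) L1 Lk C0
  (fun k v => scalar_shift_bound k v U1) (mixing_weak hP U1)
  (delta := om (yb_product D R' n)).
rewrite /= g1 om1 // mulr1 => -> // k.
by rewrite gamk om_iter_can_endo //; apply: hom_pol hP'.
Qed.

End Mixing.

(** * The normalised partial trace of an R-matrix *)

Section RMatrixTrace.
Local Open Scope sesquilinear_scope.
Variables (K : realType) (H : hilbertType K) (d : nat) (D : cuntz_gns H d).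
Hypothesis hd : (1 < d)%N.
Local Notation S := (cS D).
Local Notation om := (omega D).
Local Notation q := (d%:R : K[i]).
Local Notation F := (cuntz_flip S).
Implicit Types A B : 'M[K[i]]_(d * d).

Let HS : cuntz_relations S := cS_rel D.

Definition nptrace A : 'M[K[i]]_d := q^-1 *: ptrace_r A.

Lemma toM_exp (M : 'M[K[i]]_d) n : toM S (M ^+ n) = toM S M ^+ n.
Proof.
elim: n => [|n IH]; first by rewrite !expr0 [LHS](toM1 HS).
by rewrite !exprS -IH -(toMM HS).
Qed.

Lemma left_inverse_r_matrix A ph : r_matrix A ->
  omega_left_inverse D (to_F2 D A) ph -> ph (to_F2 D A) = toM S (nptrace A).
Proof. by move=> hA; apply: (left_inverse_yb hd (yb_traces_r_matrix D hd hA)). Qed.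

Lemma compress_r_matrix A : r_matrix A -> compress D (to_F2 D A) = toM S (nptrace A).
Proof.
move=> hA; rewrite compress_to_F2.
exact: (partial_traces_eq hd (yb_traces_r_matrix D hd hA)).
Qed.

Lemma left_inverse_flip_to_F2 A ph : omega_left_inverse D F ph ->
  ph (to_F2 D A) = compress D (to_F2 D A).
Proof.
by move=> phP; apply: (left_inverse_flip hd phP (hom_pol (to_F2_hom D A))).
Qed.

Lemma left_inverse_flip_conj A ph : omega_left_inverse D F ph ->
  ph (F * to_F2 D A * F) = toM S (nptrace A).
Proof.
move=> phP; rewrite flip_conj (left_inverse_flip_to_F2 _ phP) compress_to_F2.
by rewrite ptrace_l_swap.
Qed.

Lemma ptrace_r_matrix A : r_matrix A -> ptrace_l A = ptrace_r A.
Proof.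
move=> hA; have := compress_r_matrix hA; rewrite compress_to_F2.
move=> /(toM_inj HS (one_neq0 D hd)) /(congr1 (fun M => q *: M)).
by rewrite /nptrace !scalerA mulfV ?d_neq0 // !scale1r.
Qed.

Lemma nptrace_normal A : r_matrix A -> normal_op (toM S (nptrace A)).
Proof. by move=> hA; apply: (partial_trace_normal hd (yb_traces_r_matrix D hd hA)). Qed.

Lemma nptrace_normalmx A : r_matrix A -> nptrace A \is normalmx.
Proof.
move=> hA; apply/normalmxP; apply: (toM_inj HS (one_neq0 D hd)).
rewrite !(toMM HS) -toM_adj; exact/esym/(nptrace_normal hA).
Qed.

Lemma nptrace_contraction A : r_matrix A -> opnorm (toM S (nptrace A)) <= 1.
Proof.
move=> hA; rewrite -compress_r_matrix //; apply: compress_contraction => //.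
exact: (yb_unitary (yb_traces_r_matrix D hd hA)).
Qed.

Lemma om_yb_product_nptrace A n : r_matrix A ->
  om (yb_product D (to_F2 D A) n) = om (toM S (nptrace A) ^+ n).
Proof.
move=> hA; have := om_yb_product_pow hd (yb_traces_r_matrix D hd hA) n 0.
by rewrite expr0 mul1r addn0.
Qed.

Lemma tau_yb_product A n : r_matrix A ->
  gns_tau D (\prod_(k < n) iter k (can_endo S) (to_F2 D A)) =
    gns_tau D (toM S (nptrace A) ^+ n).
Proof.
move=> hA; have hP := yb_product_hom (yb_traces_r_matrix D hd hA) n.
rewrite (tau_om hP) om_yb_product_nptrace //.
by rewrite (tau_om (hom_exp HS n (toM_hom D (nptrace A)))).
Qed.

Lemma toM_Fn (M : 'M[K[i]]_d) : Fn S 1 (toM S M).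
Proof. exact: (hom_Fn (toM_hom D M)). Qed.

(** Equal moments [omega(R_n)] give equal power traces of two normal matrices. *)
Lemma yb_equiv_nptrace A B : r_matrix A -> r_matrix B ->
  yb_equiv D (to_F2 D A) (to_F2 D B) ->
  exists u : bop H, [/\ Fn S 1 u, unitary_op u
    & toM S (nptrace A) = u * toM S (nptrace B) * adj u].
Proof.
move=> hA hB AB.
have trE n : \tr (nptrace A ^+ n) = \tr (nptrace B ^+ n).
  apply: (@mulfI _ q^-1); first by rewrite invr_eq0 d_neq0.
  rewrite -!(om_toM D hd) !toM_exp -!om_yb_product_nptrace //.
  exact: (yb_equiv_om hd n (yb_traces_r_matrix D hd hA) (yb_traces_r_matrix D hd hB) AB).
have [U uU EU] := normal_unitary_similar (nptrace_normalmx hA) (nptrace_normalmx hB) trE.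
exists (toM S U); split; [exact: toM_Fn | exact: toM_unitary |].
by rewrite toM_adj -!(toMM HS) -EU.
Qed.

End RMatrixTrace.

Theorem theorem5p10 (K : realType) (H : hilbertType K) (d : nat) (hd : (2 <= d)%N)
  (D : cuntz_gns H d) (A B : 'M[K[i]]_(d * d))
  (hA : r_matrix A) (hB : r_matrix B)
  (phiR phiS phiF : bop H -> bop H)
  (hphiR : omega_left_inverse D (to_F2 D A) phiR)
  (hphiS : omega_left_inverse D (to_F2 D B) phiS)
  (hphiF : omega_left_inverse D (cuntz_flip (cS D)) phiF) :
  let R := to_F2 D A in
  let S := to_F2 D B in
  let F := cuntz_flip (cS D) in
  ([/\ phiR R = phiF R, phiF R = phiF (F * R * F), Fn (cS D) 1 (phiR R),
       normal_op (phiR R) & opnorm (phiR R) <= 1] /\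
   ptrace_l A = ptrace_r A) /\
  (forall n : nat,
     gns_tau D (\prod_(k < n) iter k (can_endo (cS D)) R) = gns_tau D (phiR R ^+ n)) /\
  (yb_equiv D R S ->
   exists u : bop H, [/\ Fn (cS D) 1 u, unitary_op u & phiR R = u * phiS S * adj u]).
Proof.
have fR := left_inverse_r_matrix hd hA hphiR.
have fS := left_inverse_r_matrix hd hB hphiS.
have fF := etrans (left_inverse_flip_to_F2 hd A hphiF) (compress_r_matrix D hd hA).
have fFRF := left_inverse_flip_conj hd A hphiF.
move=> R S F; split; [split|split].
- split.
  + exact: (etrans fR (esym fF)).
  + exact: (etrans fF (esym fFRF)).
  + by rewrite [phiR R]fR; apply: toM_Fn.
  + by rewrite [phiR R]fR; apply: (nptrace_normal D hd hA).
  + by rewrite [phiR R]fR; apply: (nptrace_contraction D hd hA).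
- exact: (ptrace_r_matrix D hd hA).
- by move=> n; rewrite [phiR R]fR; apply: (tau_yb_product D hd n hA).
- move=> RS; rewrite [phiR R]fR [phiS S]fS.
  exact: (yb_equiv_nptrace hd hA hB RS).
Qed.
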